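(* Let $\mu$ be doubling and let $X$ be a quasi-Banach function lattice over $(\mathcal P,\mu)$. Suppose that $\mathcal P$ supports an $s$-Poincaré inequality with dilation constant $\lambda\ge1$, where $s$ is such that the dimension condition holds with exponent $s$. Assume that $X\hookrightarrow L^s(\log L)^\alpha_{\mathrm{loc}}$ for some $\alpha\ge1$ if $s=1$, and for some $\alpha>1$ if $s>1$. Then there is a constant $C>0$ such that the following holds for every fixed ball $B_0\subset\mathcal P$ of radius $R>0$. There is a constant $c_{B_0}>0$ such that for every ball $B\subset B_0$ of radius $r\in(0,R)$, $$C_X\text{-}\operatorname*{ess\,sup}_{x\in B}|u(x)-u_B|\le C\,\frac{c_{\mathrm{emb}}(2\lambda B)\,r}{\mu(2\lambda B)^{1/s}}\,\|g\chi_{2\lambda B}\|_X \quad\text{and}\quad \frac{c_{\mathrm{emb}}(2\lambda B)\,r}{\mu(2\lambda B)^{1/s}}\,\|g\chi_{2\lambda B}\|_X\le c_{B_0}\,\|g\chi_{2\lambda B}\|_X$$ whenever $g\in X$ is an $X$-weak upper gradient of $u\in N^1X$. Moreover, $c_{B_0}$ can be chosen with $$C^{-1}K\le c_{B_0}\le CK,\qquad K=\frac{c_{\mathrm{emb}}(2\lambda B_0)\,R}{\mu(2\lambda B_0)^{1/s}}.$$ The constant $C$ is independent of $B_0$, $R$, $B$, $r$, $u$ and $g$.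
   Context: Setting. $\mathcal P=(\mathcal P,\mathrm d,\mu)$ is a metric space with a $\sigma$-finite Borel regular measure $\mu$ (all Borel sets are $\mu$-measurable, and every $\mu$-measurable set $A$ is contained in a Borel set $D$ with $\mu(D)=\mu(A)$) such that every ball has finite positive measure. A ball $B=B(x,r)$ is open and comes with its center and radius; $\lambda B=B(x,\lambda r)$. $u_B=\mu(B)^{-1}\int_Bu\,d\mu$. $\mathcal M(\mathcal P,\mu)$ is the set of all extended real-valued $\mu$-measurable functions on $\mathcal P$ (defined everywhere). Quasi-Banach function lattice: a linear space $X=\{u\in\mathcal M(\mathcal P,\mu):\|u\|_X<\infty\}$ given by a functional $\|\cdot\|_X:\mathcal M(\mathcal P,\mu)\to[0,\infty]$ such that: $\|u\|_X=0$ iff $u=0$ a.e.; $\|au\|_X=|a|\,\|u\|_X$ for $a\in\mathbb R$; there is a constant $c_\triangle\ge1$ with $\|u+v\|_X\le c_\triangle(\|u\|_X+\|v\|_X)$; if $|u|\le|v|$ a.e. then $\|u\|_X\le\|v\|_X$; and (Riesz--Fischer) if $u_n\ge0$ a.e. for all $n$ then $\|\sum_{n=1}^\infty u_n\|_X\le\sum_{n=1}^\infty c_\triangle^n\|u_n\|_X$. The quasi-norm is also assumed continuous: $\|u_n-u\|_X\to0$ implies $\|u_n\|_X\to\|u\|_X$. Newtonian space. A curve is a non-constant continuous map $\gamma$ from a compact interval into $\mathcal P$ of finite length, parametrized by arc length $ds$ on $[0,l_\gamma]$. A Borel function $g:\mathcal P\to[0,\infty]$ is an upper gradient of $u:\mathcal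 P\to[-\infty,\infty]$ if $|u(\gamma(0))-u(\gamma(l_\gamma))|\le\int_\gamma g\,ds$ for every curve $\gamma$, with the convention $|(\pm\infty)-(\pm\infty)|=\infty$. A measurable $g:\mathcal P\to[0,\infty]$ is an $X$-weak upper gradient of $u$ if this inequality holds for $\mathrm{Mod}_X$-a.e. curve, i.e. for all curves except a family $\Gamma_e$ for which there is a nonnegative Borel function $\rho\in X$ with $\int_\gamma\rho\,ds=\infty$ for all $\gamma\in\Gamma_e$. Set $\|u\|_{N^1X}=\|u\|_X+\inf_g\|g\|_X$, infimum over all upper gradients $g$ of $u$, and $N^1X=\{u\in\mathcal M(\mathcal P,\mu):\|u\|_{N^1X}<\infty\}$. Capacity. $C_X(E)=\inf\{\|u\|_{N^1X}:u\ge1\text{ on }E\}$. $C_X\text{-}\operatorname{ess\,sup}_{x\in B}f(x)$ is the infimum of all $a$ such that $C_X(\{x\in B:f(x)>a\})=0$. Doubling: there is $c_{\mathrm{dbl}}\ge1$ with $\mu(2B)\le c_{\mathrm{dbl}}\mu(B)$ for every ball $B$. Dimension condition with exponent $s>0$: there is $c_s>0$ with $\mu(B(y,r))/\mu(B(x,R))\ge c_s(r/R)^s$ whenever $0<r\le R$, $x\in\mathcal P$, $y\in B(x,R)$. $p$-Poincaré inequality ($p\in[1,\infty)$): there are $c_{\mathrm{PI}}>0$ and $\lambda\ge1$ such that $\frac1{\mu(B)}\int_B|u-u_B|\,d\mu\le c_{\mathrm{PI}}\,\mathrm{diam}(B)\bigl(\frac1{\mu(\lambda B)}\int_{\lambda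 B}g^p\,d\mu\bigr)^{1/p}$ for all balls $B$, all $u\in L^1_{\mathrm{loc}}(\mathcal P)$ and all upper gradients $g$ of $u$. Zygmund spaces. The decreasing rearrangement is $f^*(t)=\inf\{\tau\ge0:\mu(\{|f|>\tau\})\le t\}$. For $p\ge1$, $\alpha\ge0$ and measurable $E$ with $\mu(E)<\infty$, $\|u\|_{L^p(\log L)^\alpha(E)}^p=\int_0^{\mu(E)}\bigl(u^*(t)(1+\log\frac{\mu(E)}t)^\alpha\bigr)^p\,dt$. Embedding $X\hookrightarrow L^s(\log L)^\alpha_{\mathrm{loc}}$: for every ball $B$ there is a constant $c_{\mathrm{emb}}(B)>0$ with $\|u\chi_B\|_{L^s(\log L)^\alpha(B)}\le c_{\mathrm{emb}}(B)\|u\chi_B\|_X$ for all $u\in\mathcal M(\mathcal P,\mu)$; $c_{\mathrm{emb}}(B)$ denotes the smallest such constant.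
   Formalization: The ''Moreover'' (c_{B_0} comparable to K) is stated only for balls B ⊂ B_0 with also 2λB ⊂ 2λB_0; without this it fails in general metric spaces, as c_emb(2λB) need not be controlled by c_emb(2λB_0). Both displayed inequalities are kept for all B ⊂ B_0. *)

(* Defs.v *)
From HB Require Import structures.
From mathcomp Require Import all_boot all_order all_algebra.
From mathcomp Require Import all_classical all_reals all_analysis.
From mathcomp Require Import measurable_realfun.

Set Implicit Arguments.
Unset Strict Implicit.
Unset Printing Implicit Defensive.

Import Order.TTheory GRing.Theory Num.Theory.
Import numFieldNormedType.Exports.

Local Open Scope classical_set_scope.
Local Open Scope ring_scope.

#[short(type="metricMeasurableType")]
HB.structure Definition MetricMeasurable d (R : numDomainType) :=
  { T of Metric R T & Measurable d T }.

Section Spaces.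
Local Open Scope ereal_scope.
Context {d : measure_display} {R : realType} {P : metricMeasurableType d R}.
Implicit Types (mu : {measure set P -> \bar R}) (u v f g : P -> \bar R).
Implicit Types (nrm : (P -> \bar R) -> \bar R).

(* The sigma-algebra carried by [P] is that of the mu-measurable sets; the Borel
   sets form the possibly smaller family [borel_set]. *)
Definition borel_set (A : set P) : Prop := <<s [set U : set P | open U] >> A.

Definition borel_fun g : Prop :=
  measurable_fun setT (g : g_sigma_algebraType [set U : set P | open U] -> \bar R).

Record borel_regular_measure mu : Prop := {
  brm_sigma_finite : sigma_finite setT mu ;
  brm_borel : forall A, borel_set A -> measurable A ;
  brm_regular : forall A, measurable A ->
    exists2 D, borel_set D & A `<=` D /\ mu D = mu A ;
  brm_ball : forall x r, (0 < r)%R -> 0 < mu (ball x r) < +oo }.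

Definition doubling mu : Prop := exists2 cdbl : R, (1 <= cdbl)%R &
  forall x r, (0 < r)%R -> mu (ball x (2 * r)%R) <= cdbl%:E * mu (ball x r).

Definition dimension_condition mu (s : R) : Prop :=
  exists2 cs : R, (0 < cs)%R & forall (x y : P) (r r' : R),
    (0 < r <= r')%R -> ball x r' y ->
    (cs * (r / r') `^ s <= fine (mu (ball y r)) / fine (mu (ball x r')))%R.

Definition diam (A : set P) : \bar R :=
  ereal_sup [set (mdist z.1 z.2)%:E | z in A `*` A].

Definition average mu (B : set P) f : \bar R :=
  ((fine (mu B))^-1)%:E * \int[mu]_(x in B) f x.

(* Riesz-Fischer: the index starts at 1, so that [u_ 0] plays no role. *)
Record quasi_banach_lattice_with mu nrm (ctri : R) : Prop := {
  qbl_ge0 : forall u, measurable_fun setT u -> 0 <= nrm u ;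
  qbl_eq0 : forall u, measurable_fun setT u ->
    nrm u = 0 <-> {ae mu, forall x, u x = 0} ;
  qbl_scale : forall (a : R) u, measurable_fun setT u ->
    nrm (fun x => a%:E * u x) = `|a|%:E * nrm u ;
  qbl_ctri : (1 <= ctri)%R ;
  qbl_triangle : forall u v, measurable_fun setT u -> measurable_fun setT v ->
    nrm (fun x => u x + v x) <= ctri%:E * (nrm u + nrm v) ;
  qbl_mono : forall u v, measurable_fun setT u -> measurable_fun setT v ->
    {ae mu, forall x, `|u x| <= `|v x|} -> nrm u <= nrm v ;
  qbl_riesz_fischer : forall u_ : (P -> \bar R)^nat,
    (forall n, measurable_fun setT (u_ n)) ->
    (forall n, {ae mu, forall x, 0 <= u_ n x}) ->
    nrm (fun x => \sum_(1 <= n <oo) u_ n x) <=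
      \sum_(1 <= n <oo) (ctri ^+ n)%:E * nrm (u_ n) ;
  qbl_continuous : forall (u_ : (P -> \bar R)^nat) u,
    (forall n, measurable_fun setT (u_ n)) -> measurable_fun setT u ->
    (fun n => nrm (fun x => u_ n x - u x)) @ \oo --> 0 ->
    (fun n => nrm (u_ n)) @ \oo --> nrm u }.

Definition quasi_banach_lattice mu nrm : Prop :=
  exists ctri : R, quasi_banach_lattice_with mu nrm ctri.

Definition in_lattice nrm u : Prop := measurable_fun setT u /\ nrm u < +oo.

Definition path_variation (p : R -> P) (a b : R) (s : seq R) : R :=
  (\sum_(i < size s) mdist (p (nth b (a :: s) i)) (p (nth b s i)))%R.

Definition path_length (p : R -> P) (a b : R) : \bar R :=
  ereal_sup [set (path_variation p a b s)%:E | s in itv_partition a b].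

(* Curves are given by their arc-length parametrization on [0, len]; together
   with [len > 0] this makes them non-constant and of finite length. Values of
   [curve_path] outside of [0, len] are irrelevant. *)
Record curve : Type := Curve {
  len : R ;
  curve_path :> R -> P ;
  len_gt0 : (0 < len)%R ;
  curve_continuous : {within `[0%R, len], continuous curve_path} ;
  curve_arc_length : forall t : R, (0 <= t <= len)%R ->
    path_length curve_path 0%R t = t%:E }.

Definition curve_integral (gamma : curve) g : \bar R :=
  \int[lebesgue_measure]_(t in `[0%R, len gamma]) g (gamma t).

(* In [\bar R], [+oo - +oo] and [-oo - -oo] are both [-oo], so that the
   absolute value of the difference of two equal infinities is [+oo]. *)
Definition upper_gradient_along u g (gamma : curve) : Prop :=
  `|u (gamma 0%R) - u (gamma (len gamma))| <= curve_integral gamma g.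

Definition upper_gradient u g : Prop :=
  [/\ borel_fun g, forall x, 0 <= g x &
      forall gamma, upper_gradient_along u g gamma].

Definition modulus_null nrm (Gamma : set curve) : Prop :=
  exists rho, [/\ borel_fun rho, forall x, 0 <= rho x, in_lattice nrm rho &
    forall gamma, Gamma gamma -> curve_integral gamma rho = +oo].

Definition weak_upper_gradient nrm u g : Prop :=
  [/\ measurable_fun setT g, forall x, 0 <= g x &
      exists2 Gamma, modulus_null nrm Gamma &
        forall gamma, ~ Gamma gamma -> upper_gradient_along u g gamma].

Definition newtonian_norm nrm u : \bar R :=
  nrm u + ereal_inf [set nrm g | g in upper_gradient u].

Definition newtonian nrm u : Prop :=
  measurable_fun setT u /\ newtonian_norm nrm u < +oo.

Definition capacity nrm (E : set P) : \bar R :=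
  ereal_inf [set newtonian_norm nrm u | u in
    [set u | measurable_fun setT u /\ forall x, E x -> 1 <= u x]].

Definition capacity_ess_sup nrm (B : set P) f : \bar R :=
  ereal_inf [set a%:E | a in
    [set a : R | capacity nrm [set x | B x /\ a%:E < f x] = 0]].

(* Local integrability is integrability on every ball. *)
Definition poincare mu (p lambda : R) : Prop :=
  exists2 cPI : R, (0 < cPI)%R & forall (x : P) (r : R) u g, (0 < r)%R ->
    (forall y r', (0 < r')%R -> mu.-integrable (ball y r') u) ->
    upper_gradient u g ->
    average mu (ball x r) (fun y => `|u y - average mu (ball x r) u|) <=
      cPI%:E * diam (ball x r) *
      average mu (ball x (lambda * r)%R) (fun y => g y `^ p) `^ p^-1.

Definition rearrangement mu f (t : R) : \bar R :=
  ereal_inf [set tau%:E | tau in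
    [set tau : R | (0 <= tau)%R /\ mu [set x | tau%:E < `|f x|] <= t%:E]].

Definition zygmund_norm mu (p alpha : R) (E : set P) f : \bar R :=
  let m := fine (mu E) in
  (\int[lebesgue_measure]_(t in `]0%R, m[)
     (rearrangement mu f t * ((1 + ln (m / t)) `^ alpha)%:E) `^ p) `^ p^-1.

Definition embedding_constant mu nrm (s alpha : R) (B : set P) (c : R) : Prop :=
  (0 < c)%R /\ forall u, measurable_fun setT u ->
    zygmund_norm mu s alpha B (u \_ B) <= c%:E * nrm (u \_ B).

Definition smallest_embedding_constant mu nrm (s alpha : R) (B : set P) (c : R)
    : Prop :=
  embedding_constant mu nrm s alpha B c /\
  forall c', embedding_constant mu nrm s alpha B c' -> (c <= c')%R.

(* c_emb(2 lambda B) r / mu(2 lambda B)^(1/s) for B = B(x, r), where [cemb y t]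
   stands for c_emb(B(y, t)). It is comparable from above with its value at a
   larger ball B_0 only when 2 lambda B is included in 2 lambda B_0; in a
   general metric space this does not follow from the inclusion of B in B_0,
   even if the radius of B is the smaller one. *)
Definition embedding_scale mu (cemb : P -> R -> R) (s lambda : R) (x : P) (r : R)
    : R :=
  (cemb x (2 * lambda * r) * r /
     fine (mu (ball x (2 * lambda * r))) `^ s^-1)%R.

End Spaces.

(* Main.v *)
(* Let B = B(x, r), let z be a point of B and let B_k = B(z, 2^-k r). Telescoping
   the averages of u over the balls B_k, the Poincare inequality and the dimension
   condition bound |u_{B_k} - u_B| by a multiple of r / mu(2 lambda B)^(1/s) times
   the sum over k of the norms of g in L^s(lambda B_k), and each of these is at
   most the L^s norm of the rearrangement of g over ]0, mu(lambda B_k)[. Radii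
   along which the measure is not halved can be skipped, so that the k-th
   measure that remains is O(2^-k mu(2 lambda B)); the logarithmic weight of the
   Zygmund norm then makes the sum converge, as a p-series if alpha > 1 and, if
   s = alpha = 1, because the number of these measures that exceed t grows like
   log(1/t). As the oscillation of u on B_k tends to 0 uniformly in z,
   this bounds |u - u_B| almost everywhere in B. A superlevel set E of |u - u_B|
   in B that has measure zero has capacity zero: if D is a null Borel set
   containing E and g0 is an upper gradient of u, the integral of
   rho = g0 + oo.1_D is infinite along every curve that meets E, so that all the
   multiples e rho, e > 0, are upper gradients of 1_E. A weak upper gradient g is
   replaced by upper gradients g' + e h, where g' = g almost everywhere and h has
   infinite integral along the exceptional curves; e tends to 0 only in the final
   estimate, where the constant of the triangle inequality is harmless. *)

Require Import Defs.
From HB Require Import structures.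
From mathcomp Require Import all_boot all_order all_algebra.
From mathcomp Require Import all_classical all_reals all_analysis.
From mathcomp Require Import measurable_realfun.
From mathcomp Require Import ring lra.

Set Implicit Arguments.
Unset Strict Implicit.
Unset Printing Implicit Defensive.

Import Order.TTheory GRing.Theory Num.Theory.
Import numFieldNormedType.Exports.

Local Open Scope classical_set_scope.
Local Open Scope ring_scope.

(** * Subcurves *)

Section SubCurves.
Context {d : measure_display} {R : realType} {P : metricMeasurableType d R}.
Implicit Types (p : R -> P) (a b t : R) (s : seq R).

Lemma path_variation_nil p a b : path_variation p a b [::] = 0.
Proof. by rewrite /path_variation big_ord0. Qed.

Lemma path_variation_cons p a b x s :
  path_variation p a b (x :: s) = mdist (p a) (p x) + path_variation p x b s.
Proof. by rewrite /path_variation /= big_ord_recl. Qed.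

Lemma path_variation_cat p a b c s1 s2 : last a s1 = c ->
  path_variation p a b (s1 ++ s2) = path_variation p a b s1 + path_variation p c b s2.
Proof.
elim: s1 a => [|x s1 IH] a /=; first by move=> <-; rewrite path_variation_nil add0r.
by move=> xc; rewrite !path_variation_cons IH// addrA.
Qed.

(** The endpoint enters [path_variation] only as the default value of [nth], and no index reaches
    past the list. *)
Lemma path_variation_default p a b b' s :
  path_variation p a b s = path_variation p a b' s.
Proof.
by elim: s a => [|x s IH] a; rewrite ?path_variation_nil// !path_variation_cons IH.
Qed.

Lemma path_variation_shift p c a b s :
  path_variation (fun t => p (c + t)) a b s =
  path_variation p (c + a) (c + b) (map (+%R c) s).
Proof.
by elim: s a => [|x s IH] a; rewrite ?path_variation_nil//= !path_variation_cons IH.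
Qed.

Lemma itv_partition_shift c a b s : itv_partition a b s ->
  itv_partition (c + a) (c + b) (map (+%R c) s).
Proof.
move=> [ps /eqP lb]; split; last by rewrite last_map lb.
by rewrite path_map; apply: sub_path ps => x y /=; rewrite ltrD2l.
Qed.

(** The segments before [c] are paid for by the Lipschitz bound on [a, c]; the segment across [c] is
    split by the triangle inequality. *)
Lemma path_variation_insert p a b c s :
  (forall x y, a <= x <= y -> y <= b -> mdist (p x) (p y) <= y - x) ->
  a <= c <= b -> itv_partition a b s ->
  exists2 s', itv_partition c b s' &
    path_variation p a b s <= c - a + path_variation p c b s'.
Proof.
move=> lip /andP[ac cb] sab.
elim: s a ac lip sab => [|x s IH] a ac lip sab.
  have ab := itv_partition_nil sab; rewrite -{}ab in cb lip sab *.
  have -> : c = a by apply/eqP; rewrite eq_le ac cb.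
  by exists [::]; rewrite ?subrr ?add0r// /itv_partition.
have [/= /andP[ax _] _] := sab.
have xb : x <= b by exact: itv_partition_le (itv_partition_cons sab).
have [xc|cx] := leP x c.
  have [|s' s'cb h] := IH _ xc _ (itv_partition_cons sab).
    by move=> u v /andP[xu uv] vb; apply: lip => //; rewrite (le_trans (ltW ax)).
  exists s' => //; rewrite path_variation_cons.
  have := lip a x; rewrite lexx (ltW ax) => /(_ isT xb); lra.
exists (x :: s).
  by case: (itv_partition_cons sab) => h1 h2; split => //=; rewrite cx.
rewrite !path_variation_cons addrA lerD2r.
apply: (le_trans (metric_triangle _ (p c) _)); rewrite lerD2r.
by apply: lip => //; rewrite lexx.
Qed.

(** Appending [t2] to a partition of [0, t1] of variation above [t1 - e] gives a partition of
    [0, t2], of variation at most [t2]; this leaves less than [t2 - t1 + e] for the last segment. *)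
Lemma curve_lipschitz (gamma : @curve d R P) t1 t2 : 0 <= t1 <= t2 -> t2 <= len gamma ->
  mdist (gamma t1) (gamma t2) <= t2 - t1.
Proof.
move=> /andP[t10]; rewrite le_eqVlt => /predU1P[<- _|t12 t2l].
  by rewrite mdistxx subrr.
apply/ler_addgt0Pl => e e0.
have len1 := @curve_arc_length _ _ _ gamma t1.
rewrite t10 (le_trans (ltW t12) t2l) in len1.
have : ((t1 - e)%:E < path_length gamma 0 t1)%E by rewrite len1// lte_fin; lra.
move=> /ereal_sup_gt[_ /= [s s1 <-]]; rewrite lte_fin => hs.
have len2 := @curve_arc_length _ _ _ gamma t2.
rewrite (le_trans t10 (ltW t12)) t2l in len2.
have : ((path_variation gamma 0 t2 (s ++ [:: t2]))%:E <= path_length gamma 0 t2)%E.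
  apply: ereal_sup_ubound; exists (s ++ [:: t2]) => //.
  exact: itv_partition_cat s1 (itv_partition1 t12).
rewrite len2// lee_fin (@path_variation_cat _ _ _ t1); last by case: s1 => _ /eqP.
rewrite path_variation_cons path_variation_nil (path_variation_default _ _ _ t1).
lra.
Qed.

Lemma path_variation_curve (gamma : @curve d R P) a b s : 0 <= a -> b <= len gamma ->
  itv_partition a b s -> path_variation gamma a b s <= b - a.
Proof.
move=> a0 bl; elim: s a a0 => [|x s IH] a a0 sab.
  by rewrite path_variation_nil (itv_partition_nil sab) subrr.
have [/= /andP[ax _] _] := sab.
have xb : x <= b by exact: itv_partition_le (itv_partition_cons sab).
rewrite path_variation_cons.
have := IH x (le_trans a0 (ltW ax)) (itv_partition_cons sab).
have := @curve_lipschitz gamma a x; rewrite a0 (ltW ax) (le_trans xb bl).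
by move=> /(_ isT isT); lra.
Qed.

(** The upper bound sums Lipschitz bounds. For the lower one, [a] is inserted into a nearly optimal
    partition of [0, b], whose part before [a] accounts for at most [a]. *)
Lemma curve_path_length (gamma : @curve d R P) a b : 0 <= a <= b -> b <= len gamma ->
  path_length gamma a b = (b - a)%:E.
Proof.
move=> /andP[a0 ab] bl; apply/eqP; rewrite eq_le; apply/andP; split.
  apply: ge_ereal_sup => _ [s sab <-]; rewrite lee_fin.
  exact: path_variation_curve.
apply/lee_addgt0Pr => e e0.
have lenb := @curve_arc_length _ _ _ gamma b.
rewrite (le_trans a0 ab) bl in lenb.
have : ((b - e)%:E < path_length gamma 0 b)%E by rewrite lenb// lte_fin; lra.
move=> /ereal_sup_gt[_ /= [s sb <-]]; rewrite lte_fin => hs.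
have [||s' s'ab h] := @path_variation_insert gamma 0 b a s _ _ sb.
- by move=> x y xy yb; apply: curve_lipschitz => //; exact: le_trans yb bl.
- by rewrite a0.
apply: (@le_trans _ _ ((path_variation gamma a b s')%:E + e%:E)%E).
  by rewrite -EFinD lee_fin; lra.
by rewrite leeD2r//; apply: ereal_sup_ubound; exists s'.
Qed.

Lemma subcurve_len_gt0 a b : a < b -> 0 < b - a. Proof. by rewrite subr_gt0. Qed.

Lemma subcurve_path_length (gamma : @curve d R P) a b t : 0 <= a -> b <= len gamma ->
  0 <= t <= b - a -> path_length (fun x => gamma (a + x)) 0 t = t%:E.
Proof.
move=> a0 bl t0ba; have /andP[t0 tba] := t0ba.
have -> : path_length (fun x => gamma (a + x)) 0 t = path_length gamma a (a + t).
  rewrite /path_length; congr ereal_sup; apply/seteqP; split => _ [s hs <-] /=.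
    exists (map (+%R a) s).
      by move: (itv_partition_shift a hs); rewrite addr0.
    by rewrite path_variation_shift addr0.
  exists (map (+%R (- a)) s).
    by move: (itv_partition_shift (- a) hs); rewrite addNr addKr.
  rewrite path_variation_shift addr0 -map_comp.
  rewrite (_ : map _ s = s)//; elim: s {hs} => //= x s ->.
  by rewrite addNKr.
by rewrite curve_path_length; [congr EFin|..]; lra.
Qed.

Lemma subcurve_continuous (gamma : @curve d R P) a b : 0 <= a -> b <= len gamma ->
  {within `[0%R, b - a], continuous (fun x => gamma (a + x))}.
Proof.
move=> a0 bl; apply/subspace_continuousP => t /=; rewrite in_itv/= => /andP[t0 tba].
apply/metricType_numDomainType.cvgrPdist_lt => e e0; near=> u.
have : `[0%R, b - a]%classic u by near: u; exact: withinT.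
rewrite /= in_itv/= => /andP[u0 uba].
have : `|t - u| < e.
  by near: u; apply: cvg_within; exact: (nbhsx_ballx t e e0).
have [tu|ut] := leP t u; last rewrite metric_sym; last rewrite distrC.
  rewrite ler0_norm ?subr_le0// => h.
  apply: le_lt_trans (curve_lipschitz (gamma := gamma) (t1 := a + t) (t2 := a + u) _ _) _; lra.
rewrite ler0_norm ?subr_le0 ?(ltW ut)// => h.
apply: le_lt_trans (curve_lipschitz (gamma := gamma) (t1 := a + u) (t2 := a + t) _ _) _; lra.
Unshelve. all: by end_near. Qed.

(** Upper gradients control only the endpoints of whole curves, so comparing two times of one curve
    takes its restriction as a curve, shifted to start at 0. *)
Definition subcurve (gamma : @curve d R P) a b (a0 : 0 <= a) (ab : a < b)
    (bl : b <= len gamma) : @curve d R P :=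
  Curve (subcurve_len_gt0 ab) (subcurve_continuous (gamma := gamma) a0 bl)
    (fun t => subcurve_path_length (gamma := gamma) (t := t) a0 bl).

End SubCurves.

(** * Integrals along curves and their absolute continuity *)

Lemma ge0_integral_itv_shift (R : realType) (a b c : R) (f : R -> \bar R) :
  measurable_fun `[a + b, a + c] f -> (forall x, 0 <= f x)%E ->
  (\int[lebesgue_measure]_(t in `[b, c]) f (a + t)%R =
   \int[lebesgue_measure]_(t in `[(a + b)%R, (a + c)%R]) f t)%E.
Proof.
move=> mf f0.
have ma : measurable_fun [set: measurableTypeR R] (+%R a : _ -> measurableTypeR R).
  exact: measurable_funD.
pose phi0 : measurableTypeR R -> measurableTypeR R := +%R a.
pose mphi := isMeasurableFun.Build _ _ _ _ phi0 ma.
pose phi : {mfun _ >-> _} := HB.pack phi0 mphi.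
transitivity (\int[pushforward lebesgue_measure phi]_(t in
  `[(a + b)%R, (a + c)%R]) f t)%E; last first.
  apply: eq_measure_integral => //= A mA _.
  (* Translation invariance: the push-forward agrees with Lebesgue measure on half-open
     intervals. *)
  apply/esym/lebesgue_measure_unique => //= _ [[x y]] _ <-.
  rewrite /pushforward (_ : _ @^-1` _ = `]x - a, y - a]%classic); last first.
    by apply/funext => u /=; rewrite /phi0/= !in_itv/= ltrBlDl lerBrDl.
  rewrite !lebesgue_measure_itv/= !lte_fin ltrD2r; case: ifPn => // _.
  by rewrite -!EFinB; congr EFin; lra.
rewrite ge0_integral_pushforward//=.
by congr (integral _ _ _); apply/seteqP; split => x /=; rewrite !in_itv/= !lerD2l.
Qed.

Section CurveIntegral.
Context {d : measure_display} {R : realType} {P : metricMeasurableType d R}.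
Local Open Scope ereal_scope.
Implicit Types (gamma : @curve d R P) (g u : P -> \bar R).

(** Continuity pulls open sets back to relatively open sets, hence Borel sets to measurable ones; a
    merely measurable [g] may fail to be measurable along a curve. *)
Lemma borel_fun_curve gamma g : borel_fun g ->
  measurable_fun `[0%R, len gamma] (g \o gamma).
Proof.
move=> mg.
have mgam : measurable_fun `[0%R, len gamma]
    (gamma : R -> g_sigma_algebraType [set U : set P | open U]).
  apply: measurability; first by [].
  move=> _ [U oU <-].
  have := @curve_continuous _ _ _ gamma => /continuousP/(_ _ oU) h.
  exact: (open_measurable_subspace _ h).
exact: (measurableT_comp mg mgam).
Qed.

Lemma curve_integral_subcurve gamma (a b : R) (a0 : (0 <= a)%R) (ab : (a < b)%R)
    (bl : (b <= len gamma)%R) g : borel_fun g -> (forall x, 0 <= g x) ->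
  curve_integral (subcurve a0 ab bl) g =
  \int[lebesgue_measure]_(t in `[a, b]) g (gamma t).
Proof.
move=> mg g0; rewrite /curve_integral/=.
rewrite (@ge0_integral_itv_shift _ a 0 (b - a) (g \o gamma)) ?addr0//.
- by rewrite addrC subrK.
- have -> : (a + (b - a) = b)%R by rewrite addrC subrK.
  apply: (@measurable_funS _ _ _ _ `[0%R, len gamma]%classic) => //.
    by apply: subset_itv; rewrite bnd_simp.
  exact: borel_fun_curve.
- by move=> x; exact: g0.
Qed.
End CurveIntegral.

Lemma cvg_integral_truncation {d} {T : measurableType d} {R : realType}
    (mu : {measure set T -> \bar R}) (D : set T) (f : T -> \bar R) :
  measurable D -> measurable_fun D f -> (forall x, D x -> 0 <= f x)%E ->
  (\int[mu]_(x in D) Order.min (f x) n%:R%:E @[n --> \oo] -->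
   \int[mu]_(x in D) f x)%E.
Proof.
move=> mD mf f0; pose g (n : nat) x := Order.min (f x) n%:R%:E.
have mg n : measurable_fun D (g n) by apply: measurable_mine.
have g0 n x : D x -> (0 <= g n x)%E by move=> Dx; rewrite le_min f0//= lee_fin.
have nd x : D x -> nondecreasing_seq (g^~ x).
  move=> Dx n m nm; rewrite /g le_min !ge_min lexx/= lee_fin ler_nat nm.
  by rewrite orbT.
have -> : (\int[mu]_(x in D) f x = \int[mu]_(x in D) limn (g^~ x))%E.
  apply: eq_integral => x; rewrite inE => Dx.
  apply/esym/cvg_lim => //; rewrite /g; move: (f0 _ Dx).
  case: (f x) => [r|_|//]; last first.
    under eq_fun do rewrite minye.
    by apply/cvgeryP; exact: cvgr_idn.
  rewrite lee_fin => r0; apply: cvg_near_cst; near=> n.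
  apply/min_idPl; rewrite lee_fin; near: n; exact: nbhs_infty_ger.
exact: cvg_monotone_convergence.
Unshelve. all: by end_near. Qed.

(** Some truncation of [f] at a height [n] has an integral within [e / 2] of that of [f], and its
    integral over a set of measure [delta] is at most [n * delta]. *)
Lemma ge0_integral_abs_continuous {d} {T : measurableType d} {R : realType}
    (mu : {measure set T -> \bar R}) (D : set T) (f : T -> \bar R) (e : R) :
  measurable D -> measurable_fun D f -> (forall x, D x -> 0 <= f x)%E ->
  (\int[mu]_(x in D) f x < +oo)%E -> 0 < e ->
  exists2 delta : R, 0 < delta & forall A, measurable A -> A `<=` D ->
    (mu A <= delta%:E)%E -> (\int[mu]_(x in A) f x < e%:E)%E.
Proof.
move=> mD mf f0 foo e0.
pose g (n : nat) x := Order.min (f x) n%:R%:E.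
have mg n : measurable_fun D (g n) by apply: measurable_mine.
have g0 n x : D x -> (0 <= g n x)%E by move=> Dx; rewrite le_min f0//= lee_fin.
have gf n x : (g n x <= f x)%E by rewrite ge_min lexx.
have nd x : D x -> nondecreasing_seq (g^~ x).
  move=> Dx n m nm; rewrite /g le_min !ge_min lexx/= lee_fin ler_nat nm.
  by rewrite orbT.
have fin : (\int[mu]_(x in D) f x)%E \is a fin_num by rewrite ge0_fin_numE// integral_ge0.
have cvf : (\int[mu]_(x in D) g n x @[n --> \oo] --> \int[mu]_(x in D) f x)%E.
  exact: cvg_integral_truncation.
have : (\int[mu]_(x in D) f x - (e / 2)%:E < \int[mu]_(x in D) f x)%E.
  by rewrite lteBlDr// lteDl// lte_fin divr_gt0.
have supE : (ereal_sup (range (fun n => \int[mu]_(x in D) g n x)) = \int[mu]_(x in D) f x)%E.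
  rewrite -(cvg_lim _ cvf)//; apply/esym/cvg_lim => //.
  apply: ereal_nondecreasing_cvgn => i j ij.
  by apply: ge0_le_integral => // x Dx; [exact: g0|exact: nd].
rewrite -{2}supE => /ereal_sup_gt[_ /= [n _ <-]].
rewrite EFinN lteBlDr// => hn.
(* The successor keeps the denominator positive when [n = 0]. *)
exists (e / 2 / n.+1%:R); first by rewrite !divr_gt0.
move=> A mA AD muA.
have mfA : measurable_fun A f by exact: measurable_funS mf.
have DE : D = A `|` (D `\` A) by rewrite setDUK.
have split_int (h : T -> \bar R) : measurable_fun D h -> (forall x, D x -> 0 <= h x)%E ->
    (\int[mu]_(x in D) h x = \int[mu]_(x in A) h x + \int[mu]_(x in D `\` A) h x)%E.
  move=> mh h0; rewrite {1}DE ge0_integral_setU -?DE//.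
  - exact: measurableD.
  - by rewrite disj_set2E setDIK.
have : (\int[mu]_(x in A) f x + \int[mu]_(x in D `\` A) f x <
        \int[mu]_(x in D `\` A) f x + e%:E)%E.
  rewrite -split_int//; apply: (lt_le_trans hn).
  rewrite split_int//; last by move=> x; exact: g0.
  have -> : e%:E = ((e / 2)%:E + (e / 2)%:E)%E by rewrite -EFinD -splitr.
  rewrite [leRHS]addeA leeD2r// [leRHS]addeC; apply: leeD.
    apply: (@le_trans _ _ (\int[mu]_(x in A) cst n%:R%:E x)%E).
      apply: ge0_le_integral => //.
      - by move=> x Ax; exact/g0/AD.
      - exact: measurable_funS (mg n).
      - by move=> x Ax; rewrite /g ge_min lexx orbT.
    rewrite integral_cst//; apply: (@le_trans _ _ (n%:R%:E * (e / 2 / n.+1%:R)%:E)%E).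
      by rewrite lee_wpmul2l// lee_fin.
    rewrite -EFinM lee_fin mulrA ler_pdivrMr// mulrC.
    by rewrite ler_wpM2l ?ler_nat// divr_ge0// ltW.
  apply: ge0_le_integral => //.
  - exact: measurableD.
  - by move=> x [Dx _]; exact: g0.
  - by apply: measurable_funS (mg n) => // x [].
  - by apply: measurable_funS mf => // x [].
rewrite addeC lteD2lE// ge0_fin_numE; last by apply: integral_ge0 => x [/f0].
apply: le_lt_trans foo; apply: ge0_subset_integral => //.
exact: measurableD.
Qed.

(** * Null sets and capacity *)

Section NullSetsAlongCurves.
Context {d : measure_display} {R : realType} {P : metricMeasurableType d R}.
Local Open Scope ereal_scope.
Implicit Types (gamma : @curve d R P) (g u rho : P -> \bar R).

Lemma abse_distC (x y : \bar R) : `|x - y| = `|y - x|.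
Proof. by case: x y => [x| |] [y| |]//; rewrite -!EFinB/= distrC. Qed.

Lemma metric_ball_open (x : P) (r : R) : open (ball x r).
Proof.
rewrite openE => y; rewrite ballEmdist /= => xyr.
apply/nbhs_ballP; exists (r - mdist x y)%R; first by rewrite /= subr_gt0.
move=> z; rewrite !ballEmdist/= => h.
by apply: le_lt_trans (metric_triangle _ y _) _; rewrite -ltrBrDl.
Qed.

Lemma upper_gradient_subcurve u g gamma a b : upper_gradient u g ->
  (0 <= a)%R -> (a < b)%R -> (b <= len gamma)%R ->
  `|u (gamma a) - u (gamma b)| <= \int[lebesgue_measure]_(t in `[a, b]) g (gamma t).
Proof.
move=> [mg g0 ug] a0 ab bl.
have := ug (subcurve a0 ab bl); rewrite /upper_gradient_along curve_integral_subcurve//=.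
by rewrite addr0 (addrC a) subrK.
Qed.

(** The interval extends to the right of [t0], except when [t0 = l], where it extends to the
    left. *)
Lemma itv_around (l t0 e : R) : (0 < l)%R -> (0 <= t0 <= l)%R -> (0 < e)%R ->
  exists t : R * R, [/\ (0 <= t.1 < t.2)%R, (t.2 <= l)%R, (t.1 <= t0 <= t.2)%R &
    (t.2 - t.1 <= e)%R].
Proof.
move=> l0 /andP[t00 t0l] e0; have [tl|lt] := ltP t0 l.
  exists (t0, t0 + Num.min e (l - t0))%R; split => /=.
  - by rewrite t00 ltrDl lt_min e0 subr_gt0.
  - by rewrite -lerBrDl ge_min lexx orbT.
  - by rewrite lexx lerDl le_min ltW//= subr_ge0.
  - by rewrite addrC addKr ge_min lexx.
exists (l - Num.min e l, l)%R; split => //=.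
- by rewrite subr_ge0 ge_min lexx orbT /= ltrBlDr ltrDl lt_min e0.
- by rewrite t0l andbT (le_trans _ lt)// lerBlDr lerDl le_min ltW//= ltW.
- by rewrite opprB addrC subrK ge_min lexx.
Qed.

Lemma itv_dist (t1 t2 t t' : R) : (t1 <= t <= t2)%R -> (t1 <= t' <= t2)%R ->
  (`|t - t'| <= t2 - t1)%R.
Proof. by move=> *; rewrite ler_norml; lra. Qed.

Lemma curve_dist gamma t t' : (0 <= t <= len gamma)%R -> (0 <= t' <= len gamma)%R ->
  (mdist (gamma t) (gamma t') <= `|t - t'|)%R.
Proof.
move=> /andP[t0 tl] /andP[t'0 t'l]; have [tt'|t't] := leP t t'.
  by rewrite distrC ger0_norm ?subr_ge0// curve_lipschitz ?t0.
by rewrite metric_sym gtr0_norm ?subr_gt0// curve_lipschitz ?t'0// ltW.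
Qed.

(* If the integral were finite, [u] would be continuous along [gamma] with
   finite values, so that [gamma] would stay in the superlevel set, hence in [D],
   during a time interval of positive length. *)
Lemma curve_integral_infty_of_hit u g (B D : set P) (c a : R) gamma (t0 : R) :
  upper_gradient u g -> open B -> borel_set D ->
  [set x | B x /\ a%:E < `|u x - c%:E|] `<=` D ->
  (0 <= t0 <= len gamma)%R -> B (gamma t0) -> a%:E < `|u (gamma t0) - c%:E| ->
  curve_integral gamma (fun x => g x + ((cst +oo) \_ D) x) = +oo.
Proof.
move=> ug oB bD ED t0l Bt0 at0; have [mg g0 _] := ug.
set rho := fun x => _.
have mrho : borel_fun rho.
  apply: emeasurable_funD => //; apply/(measurable_restrictT _ _).1 => //.
have rho0 x : 0 <= rho x.
  by apply: adde_ge0 => //; apply: erestrict_ge0 => y _; exact: leey.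
have grho x : g x <= rho x.
  by rewrite leeDl//; apply: erestrict_ge0 => y _; exact: leey.
have mh := borel_fun_curve (gamma := gamma) mrho.
apply/eqP; rewrite -leye_eq leNgt; apply/negP => foo.
have sub a' b' : (0 <= a')%R -> (b' <= len gamma)%R ->
    `[a', b']%classic `<=` `[0%R, len gamma]%classic.
  by move=> ? ?; apply: subset_itv; rewrite bnd_simp.
have near_t0 a' b' : (0 <= a')%R -> (a' < b')%R -> (b' <= len gamma)%R ->
    `|u (gamma a') - u (gamma b')| <= \int[lebesgue_measure]_(t in `[a', b']) (rho \o gamma) t.
  move=> a0 ab bl; apply: le_trans (upper_gradient_subcurve ug a0 ab bl) _.
  apply: ge0_le_integral => //.
  - by apply: measurable_funS (borel_fun_curve (gamma := gamma) mg) => //; exact: sub.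
  - by apply: measurable_funS mh => //; exact: sub.
have lt_oo a' b' : (0 <= a')%R -> (b' <= len gamma)%R ->
    \int[lebesgue_measure]_(t in `[a', b']) (rho \o gamma) t < +oo.
  move=> a0 bl; apply: le_lt_trans foo; apply: ge0_subset_integral => //.
    by move=> x _; exact: rho0.
  exact: sub.
have [t00 _] := andP t0l.
(* Equal infinities are at distance [+oo] by convention, so a finite difference with the value at
   some time forces a finite value at [t0]. *)
have [u0 u0E] : exists u0 : R, u (gamma t0) = u0%:E.
  have [[t1 t2]/= [/andP[t10 t12] t2l /andP[t1t0 t0t2] _]] := itv_around (len_gt0 gamma) t0l ltr01.
  have : exists t : R, `|u (gamma t0) - u (gamma t)| < +oo.
    have [tt|tt] := ltP t0 t2.
      by exists t2; apply: le_lt_trans (near_t0 _ _ _ _ _) (lt_oo _ _ _ _).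
    have {tt t0t2} tt : t0 = t2 by apply/le_anti/andP.
    exists t1; rewrite tt abse_distC.
    by apply: le_lt_trans (near_t0 _ _ _ _ _) (lt_oo _ _ _ _).
  case=> t; case: (u (gamma t0)) => [r _||]; first by exists r.
  - by case: (u (gamma t)).
  - by case: (u (gamma t)).
(* [Eta] is the margin at [t0]: while [u] moves by less than [Eta], it stays above the level [a]. *)
have [Eta e0] : exists2 e : R, (0 < e)%R & (a + e)%:E = `|u (gamma t0) - c%:E|.
  exists (`|u0 - c| - a)%R; last by rewrite u0E -EFinB/= addrC subrK.
  by move: at0; rewrite u0E -EFinB/= lte_fin subr_gt0.
rewrite u0E -EFinB/= => -[EtaE].
have [e1 e10 Be] : exists2 e1 : R, (0 < e1)%R & ball (gamma t0) e1 `<=` B.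
  have : nbhs (gamma t0) B by exact: open_nbhs_nbhs.
  by move=> /nbhs_ballP[e1 /= e10 h]; exists e1.
have [dl dl0 Hdl] := @ge0_integral_abs_continuous _ _ _ lebesgue_measure
  `[0%R, len gamma] (rho \o gamma) Eta (measurable_itv _) mh
  (fun x _ => rho0 _) foo e0.
(* On an interval of length at most [m], the integral of [rho] stays below [Eta] and the curve stays
   in [B]. *)
pose m : R := Num.min dl (e1 / 2)%R.
have m0 : (0 < m)%R by rewrite lt_min dl0 divr_gt0.
have [[t1 t2]/= [/andP[t10 t12] t2l /andP[t1t0 t0t2] t21]] :=
  itv_around (len_gt0 gamma) t0l m0.
have JE t : (t1 <= t <= t2)%R -> rho (gamma t) = +oo.
  move=> /andP[t1t tt2].
  have Bt : B (gamma t).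
    apply: Be; rewrite ballEmdist/=.
    have e2 : (e1 / 2 < e1)%R by rewrite ltr_pdivrMr// ltr_pMr// ltr1n.
    have me : (m <= e1 / 2)%R by rewrite ge_min lexx orbT.
    apply: le_lt_trans (curve_dist _ _) _ => //.
      by rewrite (le_trans t10 t1t) (le_trans tt2).
    apply: le_lt_trans e2; apply: le_trans me; apply: le_trans t21.
    by apply: itv_dist; rewrite ?t1t0 ?t1t.
  have ut : `|u (gamma t) - u (gamma t0)| < Eta%:E.
    have small a' b' : (t1 <= a')%R -> (a' < b')%R -> (b' <= t2)%R ->
        \int[lebesgue_measure]_(t in `[a', b']) (rho \o gamma) t < Eta%:E.
      move=> h1 h2 h3; apply: Hdl => //;
        first by apply: sub; [exact: le_trans t10 h1|exact: le_trans h3 t2l].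
      rewrite /= lebesgue_measure_itv/= lte_fin h2 -EFinB lee_fin.
      have mdl : (m <= dl)%R by rewrite ge_min lexx.
      by apply: le_trans mdl; apply: le_trans t21; exact: lerB.
    have [tt0|t0t|->] := ltgtP t t0.
    - apply: le_lt_trans (near_t0 _ _ _ _ _) (small _ _ _ _ _) => //.
        exact: le_trans t10 t1t.
      exact: le_trans t0t2 t2l.
    - rewrite abse_distC.
      apply: le_lt_trans (near_t0 _ _ _ _ _) (small _ _ _ _ _) => //.
      exact: le_trans tt2 t2l.
    - by rewrite u0E -EFinB subrr/= normr0.
  have Dt : D (gamma t).
    apply: ED; split => //.
    move: ut; rewrite u0E; case: (u (gamma t)) => [v||]//=.
    rewrite !lte_fin => uv.
    have := ler_distD v u0 c; rewrite (distrC u0 v) -EtaE => h.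
    by rewrite -(ltrD2r Eta); apply: le_lt_trans h _; rewrite [ltRHS]addrC ltrD2r.
  by rewrite /rho patchE mem_set// addey// gt_eqF// (lt_le_trans _ (g0 _)).
have : \int[lebesgue_measure]_(t in `[t1, t2]) (rho \o gamma) t = +oo.
  rewrite (eq_integral (cst +oo)); last first.
    by move=> t; rewrite inE/= in_itv/=; exact: JE.
  rewrite integral_cst//= lebesgue_measure_itv/= lte_fin t12 -EFinB.
  by rewrite gt0_mulye// lte_fin subr_gt0.
have := lt_oo t1 t2 t10 t2l => /[swap] ->.
by rewrite ltxx.
Qed.
End NullSetsAlongCurves.

Section CapacityOfNullSets.
Context {d : measure_display} {R : realType} {P : metricMeasurableType d R}.
Context (mu : {measure set P -> \bar R}) (nrm : (P -> \bar R) -> \bar R) (ctri : R).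
Local Open Scope ereal_scope.
Hypothesis Hmu : borel_regular_measure mu.
Hypothesis Hnrm : quasi_banach_lattice_with mu nrm ctri.
Implicit Types (g u rho : P -> \bar R).

Lemma borel_fun_measurable g : borel_fun g -> measurable_fun setT g.
Proof.
move=> mg _ Y mY; rewrite setTI; apply: (brm_borel Hmu).
by have := mg measurableT Y mY; rewrite setTI.
Qed.

Lemma open_borel_set (B : set P) : open B -> borel_set B.
Proof. by move=> oB; exact: sub_sigma_algebra. Qed.

Lemma measurable_open (B : set P) : open B -> measurable B.
Proof. by move=> /open_borel_set; exact: (brm_borel Hmu). Qed.

Lemma upper_gradient_norm_ge0 u : 0 <= ereal_inf [set nrm g | g in upper_gradient u].
Proof.
apply: le_ereal_inf_tmp => _ [g [mg _ _] <-].
exact/(qbl_ge0 Hnrm)/borel_fun_measurable.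
Qed.

Lemma newtonian_norm_ge0 u : measurable_fun setT u -> 0 <= newtonian_norm nrm u.
Proof.
by move=> mu_; apply: adde_ge0; [exact: qbl_ge0 Hnrm _ mu_|exact: upper_gradient_norm_ge0].
Qed.

Lemma newtonian_in_lattice u : newtonian nrm u -> in_lattice nrm u.
Proof.
move=> [mu_ ufin]; split => //; apply: le_lt_trans ufin.
by rewrite leeDl//; exact: upper_gradient_norm_ge0.
Qed.

Lemma newtonian_upper_gradient u : newtonian nrm u ->
  exists2 g, upper_gradient u g & nrm g < +oo.
Proof.
move=> [mu_ ufin].
have : ereal_inf [set nrm g | g in upper_gradient u] < +oo.
  by apply: le_lt_trans ufin; rewrite leeDr//; exact: qbl_ge0 Hnrm _ mu_.
by move=> /ereal_inf_lt[_ [g ug <-] goo]; exists g.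
Qed.

Lemma norm_null_indic (h : \bar R) (E : set P) : measurable E -> mu E = 0 ->
  nrm ((cst h) \_ E) = 0.
Proof.
move=> mE E0; apply/(qbl_eq0 Hnrm).
  by apply/(measurable_restrictT _ mE).1; exact: measurable_cst.
exists E; split => // x; apply: contra_notP => xE.
by rewrite /= patchN// notin_setE.
Qed.

Lemma capacity_null_of_null u (B : set P) (c a : R) :
  newtonian nrm u -> open B ->
  mu [set x | B x /\ a%:E < `|u x - c%:E|] = 0 ->
  capacity nrm [set x | B x /\ a%:E < `|u x - c%:E|] = 0.
Proof.
move=> uN oB; set E := [set x | _] => E0.
have [mu_ _] := uN.
have mE : measurable E.
  have -> : E = B `&` [set x | a%:E < `|u x - c%:E|] by [].
  apply: emeasurable_fun_o_infty; first exact: measurable_open.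
  apply: measurableT_comp => //; apply: emeasurable_funB => //.
  exact: measurable_funTS.
have [D bD [ED DE]] := brm_regular Hmu mE.
have mD := brm_borel Hmu bD.
have {DE} D0 : mu D = 0 by rewrite DE.
have [g ug goo] := newtonian_upper_gradient uN.
have [mg g0 _] := ug.
pose rho x := g x + ((cst +oo) \_ D) x.
have mrho : borel_fun rho.
  apply: emeasurable_funD => //; apply/(measurable_restrictT _ _).1 => //.
have rho0 x : 0 <= rho x.
  by apply: adde_ge0 => //; apply: erestrict_ge0 => y _; exact: leey.
have rhofin : nrm rho < +oo.
  apply: le_lt_trans (qbl_triangle Hnrm _ _) _.
  - exact: borel_fun_measurable.
  - by apply/(measurable_restrictT _ mD).1; exact: measurable_cst.
  - by rewrite norm_null_indic// adde0 lte_mul_pinfty// lee_fin (le_trans ler01)// (qbl_ctri Hnrm).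
have mrho' := borel_fun_measurable mrho.
have m1E : measurable_fun setT ((cst 1) \_ E : P -> \bar R).
  by apply/(measurable_restrictT _ mE).1; exact: measurable_cst.
have ug1E e : (0 < e)%R -> upper_gradient ((cst 1) \_ E) (fun x => e%:E * rho x).
  move=> e0; split.
  - by apply: emeasurable_funM => //; exact: measurable_cst.
  - by move=> x; rewrite mule_ge0// lee_fin ltW.
  move=> gamma; rewrite /upper_gradient_along.
  (* A curve that meets [E] has infinite integral; along one that misses [E], the indicator vanishes
     at both ends. *)
  have [hit|nohit] := pselect (exists2 t, (0 <= t <= len gamma)%R & E (gamma t)).
    have [t tl [Bt at_]] := hit.
    have infty := curve_integral_infty_of_hit ug oB bD ED tl Bt at_.
    rewrite [X in _ <= X](_ : _ = +oo) ?leey//.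
    rewrite /curve_integral ge0_integralZl//.
    - by move: infty; rewrite /curve_integral => ->; rewrite gt0_muley// lte_fin.
    - exact: borel_fun_curve.
    - by rewrite lee_fin ltW.
  have notE t : (0 <= t <= len gamma)%R -> ((cst 1) \_ E) (gamma t) = 0.
    by move=> tl; rewrite patchN// notin_setE => Et; apply: nohit; exists t.
  rewrite !notE ?lexx ?(ltW (len_gt0 gamma))// sube0 abse0.
  by apply: integral_ge0 => t _; rewrite mule_ge0// lee_fin ltW.
apply/eqP; rewrite eq_le; apply/andP; split; last first.
  by apply: le_ereal_inf_tmp => _ [v [mv _] <-]; exact: newtonian_norm_ge0.
apply: (@le_trans _ _ (newtonian_norm nrm ((cst 1) \_ E))).
  apply: ereal_inf_lbound; exists ((cst 1) \_ E) => //; split => // x Ex.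
  by rewrite patchE mem_set.
rewrite /newtonian_norm norm_null_indic// add0e.
apply/lee_addgt0Pr => e e0; rewrite add0e.
have rho_ge0 := qbl_ge0 Hnrm mrho'.
have rfin : nrm rho \is a fin_num by rewrite ge0_fin_numE.
(* Adding one covers the case where [rho] has norm zero. *)
pose e' := (e / (fine (nrm rho) + 1))%R.
have r1 : (0 < fine (nrm rho) + 1)%R by rewrite ltr_wpDl// fine_ge0.
have e'0 : (0 < e')%R by rewrite divr_gt0.
apply: (@le_trans _ _ (nrm (fun x => e'%:E * rho x))).
  by apply: ereal_inf_lbound; exists (fun x => e'%:E * rho x) => //; exact: ug1E.
rewrite (qbl_scale Hnrm)// gtr0_norm// -(fineK rfin) -EFinM lee_fin.
by rewrite /e' mulrAC ler_pdivrMr// ler_wpM2l ?ltW// ltrDl.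
Qed.

End CapacityOfNullSets.

(** * Decreasing rearrangements and Zygmund norms *)

Section Rearrangement.
Context {d : measure_display} {R : realType} {P : metricMeasurableType d R}.
Context (mu : {measure set P -> \bar R}).
Local Open Scope ereal_scope.
Implicit Types (f : P -> \bar R).

Lemma rearrangement_ge0 f t : 0 <= rearrangement mu f t.
Proof. by apply: le_ereal_inf_tmp => _ [tau [tau0 _] <-]; rewrite lee_fin. Qed.

Lemma le_rearrangement f t t' : (t <= t')%R ->
  rearrangement mu f t' <= rearrangement mu f t.
Proof.
move=> tt'; apply: ereal_inf_le_tmp => _ [tau [tau0 h] <-]; exists tau => //; split=> //.
by apply: le_trans h _; rewrite lee_fin.
Qed.

Lemma measurable_superlevel f (tau : \bar R) : measurable_fun setT f ->
  measurable [set x | tau < `|f x|].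
Proof.
move=> mf; rewrite -[X in measurable X]setTI.
by apply: emeasurable_fun_o_infty => //; exact: measurableT_comp.
Qed.

Lemma rearrangement_ge f (t tau : R) : measurable_fun setT f ->
  t%:E < mu [set x | tau%:E < `|f x|] -> tau%:E <= rearrangement mu f t.
Proof.
move=> mf ht; apply: le_ereal_inf_tmp => _ [tau' [_ h] <-]; rewrite lee_fin leNgt.
apply/negP => tt; move: ht; rewrite ltNge => /negP; apply; apply: le_trans h.
apply: le_measure; rewrite ?inE; try exact: measurable_superlevel.
by move=> x /=; apply: lt_trans; rewrite lte_fin.
Qed.

(** The rearrangement is monotone, so its superlevel sets are intervals. *)
Lemma measurable_rearrangement f (D : set R) : measurable D ->
  measurable_fun D (rearrangement mu f).
Proof.
move=> mD; apply: measurable_funS (measurableT) _ _ => //.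
apply: (measurability _ (ErealGenOInfty.measurableE R)) => _ [_ [x ->] <-].
rewrite setTI; apply: is_interval_measurable => t1 t2 /= h1 h2 t /andP[t1t tt2].
move: h2; rewrite !in_itv/= !andbT => /lt_le_trans; apply.
exact: le_rearrangement.
Qed.

(** Rounding to multiples of [h] costs at most one step. Levels are counted strictly here and weakly
    in [sum_layers_le], since [rearrangement_ge] turns a strict superlevel set into a weak bound. *)
Lemma mine_layers (h : R) (K : nat) (y : \bar R) : (0 < h)%R -> 0 <= y ->
  mine y (K%:R * h)%:E <=
  h%:E + \sum_(i < K) h%:E * (\1_[set z : \bar R | ((i.+1%:R * h)%:E < z)%E] y)%:E.
Proof.
move=> h0 y0; elim: K => [|K IH].
  by rewrite big_ord0 adde0 mul0r ge_min lee_fin (ltW h0) orbT.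
rewrite big_ord_recr/=.
have pos : 0 <= h%:E * (\1_[set z : \bar R | ((K.+1%:R * h)%:E < z)%E] y)%:E.
  by rewrite mule_ge0// lee_fin// ltW.
have [yK|Ky] := leP y (K%:R * h)%:E.
  rewrite addeA; apply: (@le_trans _ _ (mine y (K%:R * h)%:E)).
    by rewrite (min_idPl yK) ge_min lexx.
  by apply: (le_trans IH); rewrite leeDl.
have full : \sum_(i < K) h%:E * (\1_[set z : \bar R | ((i.+1%:R * h)%:E < z)%E] y)%:E
    = (K%:R * h)%:E.
  rewrite (eq_bigr (fun=> h%:E)); last first.
    move=> i _; rewrite indicE mem_set ?mule1//=; apply: le_lt_trans Ky.
    by rewrite lee_fin ler_wpM2r ?(ltW h0)// ler_nat.
  by rewrite sumEFin sumr_const card_ord mulr_natl.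
rewrite full addeA -EFinD; apply: (@le_trans _ _ (h + K%:R * h)%:E).
  by rewrite ge_min lee_fin -natr1 mulrDl mul1r addrC lexx orbT.
by rewrite lee_fin lerDl; exact: pos.
Qed.

Lemma sum_layers_le (h : R) (K : nat) (z : \bar R) : (0 <= h)%R -> 0 <= z ->
  \sum_(i < K) h%:E * (\1_[set z : \bar R | ((i.+1%:R * h)%:E <= z)%E] z)%:E <= z.
Proof.
move=> h0 z0; elim: K => [|K IH]; first by rewrite big_ord0.
have [Kz|zK] := leP (K.+1%:R * h)%:E z.
  apply: le_trans Kz; apply: (@le_trans _ _ (\sum_(i < K.+1) h%:E)).
    apply: lee_sum => i _; rewrite indicE; case: (_ \in _); rewrite ?mule1//.
    by rewrite mule0 lee_fin.
  by rewrite sumEFin sumr_const card_ord mulr_natl.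
rewrite big_ord_recr/= indicE memNset ?mule0 ?adde0//=.
by apply/negP; rewrite -ltNge.
Qed.

(* Slicing both sides into layers only requires [rearrangement_ge], and not that
   [f] and its rearrangement are equimeasurable. *)
Lemma hardy_littlewood f (s a : R) (A : set P) : (0 < s)%R ->
  measurable_fun setT f -> measurable A -> mu A <= a%:E ->
  \int[mu]_(x in A) (`|f x| `^ s) <=
  \int[lebesgue_measure]_(t in `]0%R, a[) (rearrangement mu f t `^ s).
Proof.
move=> s0 mf mA muA.
have mphi : measurable_fun A (fun x => `|f x| `^ s).
  apply: (measurableT_comp (measurable_poweR _)).
  by apply: measurableT_comp => //; exact: measurable_funTS.
have cvt := cvg_integral_truncation (mu := mu) mA mphi (fun x _ => poweR_ge0 _ _).
have a0 : (0 <= a)%R by rewrite -lee_fin; exact: le_trans muA.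
rewrite -(cvg_lim _ cvt)//; apply: lime_le; first by apply/cvg_ex; eexists; exact: cvt.
near=> N; apply/lee_addgt0Pr => e e0.
(* The rounding error over [A] is at most [h * a <= e]. *)
pose h := (e / (a + 1))%R.
have h0 : (0 < h)%R by rewrite divr_gt0// ltr_wpDl.
(* With this [K] the levels reach the truncation height [N]. *)
pose K := (Num.truncn (N%:R / h)).+1.
have NK : (N%:R <= K%:R * h)%R.
  by rewrite -ler_pdivrMr// ltW// truncnS_gt.
pose S i := [set x | ((i.+1%:R * h)%:E < `|f x| `^ s)%E].
have mS i : measurable (S i).
  rewrite -[X in measurable X]setTI; apply: emeasurable_fun_o_infty => //.
  apply: (measurableT_comp (measurable_poweR _)).
  exact: measurableT_comp.
have fin i : mu (S i `&` A) \is a fin_num.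
  rewrite ge0_fin_numE//; apply: (@le_lt_trans _ _ a%:E); last exact: ltry.
  apply: le_trans muA; apply: le_measure; rewrite ?inE//; exact: measurableI.
pose b i := fine (mu (S i `&` A)).
have bE i : (b i)%:E = mu (S i `&` A) by rewrite fineK.
have b0 i : (0 <= b i)%R by rewrite fine_ge0.
have ba i : (b i <= a)%R.
  rewrite -lee_fin bE; apply: le_trans muA; apply: le_measure; rewrite ?inE//.
  exact: measurableI.
have le1 : \int[mu]_(x in A) mine (`|f x| `^ s) N%:R%:E <=
    \int[mu]_(x in A) (h%:E + \sum_(i < K) h%:E * (\1_(S i) x)%:E).
  apply: ge0_le_integral => //.
  - by move=> x _; rewrite le_min poweR_ge0/= lee_fin.
  - by apply: measurable_mine.
  - apply: emeasurable_funD => //; apply: emeasurable_sum => i.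
    apply: emeasurable_funM => //; apply/measurable_EFinP.
    exact: measurable_indic.
  move=> x _; apply: le_trans (mine_layers K h0 (poweR_ge0 _ _)).
  by rewrite le_min !ge_min lexx/= lee_fin NK orbT.
have le2 : \int[mu]_(x in A) (h%:E + \sum_(i < K) h%:E * (\1_(S i) x)%:E) <=
    e%:E + \sum_(i < K) h%:E * (b i)%:E.
  rewrite ge0_integralD//; last 3 first.
  - by move=> x _; rewrite lee_fin ltW.
  - by move=> x _; apply: sume_ge0 => i _; rewrite mule_ge0// lee_fin// ltW.
  - apply: emeasurable_sum => i.
    apply: emeasurable_funM => //; apply/measurable_EFinP.
    exact: measurable_indic.
  apply: leeD.
    rewrite integral_cst//; apply: (@le_trans _ _ (h%:E * a%:E)).
      by rewrite lee_wpmul2l// lee_fin ltW.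
    rewrite -EFinM lee_fin /h mulrAC ler_pdivrMr ?ltr_wpDl//.
    by rewrite ler_wpM2l ?(ltW e0)// lerDl.
  rewrite ge0_integral_sum//.
  - apply: lee_sum => i _; rewrite ge0_integralZl_EFin//; last 2 first.
    + by apply/measurable_EFinP; exact: measurable_indic.
    + exact: ltW.
    by rewrite integral_indic// bE.
  - move=> i; apply: emeasurable_funM => //; apply/measurable_EFinP.
    exact: measurable_indic.
  - by move=> i x _; rewrite mule_ge0// lee_fin// ltW.
apply: (le_trans le1); apply: (le_trans le2); rewrite addeC leeD2r//.
(* A layer of measure [b i] is replaced by the interval []0, b i[] of the same length; below,
   [t < b i] puts the level under the rearrangement at [t]. *)
have -> : \sum_(i < K) h%:E * (b i)%:E =
    \int[lebesgue_measure]_(t in `]0%R, a[)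
      (\sum_(i < K) h%:E * (\1_(`]0%R, b i[) t)%:E).
  rewrite ge0_integral_sum//; last 2 first.
  - move=> i; apply: emeasurable_funM => //; apply/measurable_EFinP.
    exact: measurable_indic.
  - by move=> i x _; rewrite mule_ge0// lee_fin// ltW.
  apply: eq_bigr => i _; rewrite ge0_integralZl_EFin//; last 2 first.
  + by apply/measurable_EFinP; exact: measurable_indic.
  + exact: ltW.
  rewrite integral_indic//; congr (_ * _).
  have -> : `]0%R, b i[%classic `&` `]0%R, a[%classic = `]0%R, b i[%classic.
    by apply/setIidl; apply: subset_itvl; rewrite bnd_simp.
  rewrite /= lebesgue_measure_itv/= lte_fin; case: ltP => [_|].
    by rewrite oppr0 adde0.
  by move=> bi; congr EFin; apply/eqP; rewrite eq_le bi b0.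
apply: ge0_le_integral => //.
- by move=> t _; apply: sume_ge0 => i _; rewrite mule_ge0// lee_fin// ltW.
- apply: emeasurable_sum => i.
  apply: emeasurable_funM => //; apply/measurable_EFinP.
  exact: measurable_indic.
- apply: (measurableT_comp (measurable_poweR _)).
  exact: measurable_rearrangement.
move=> t _; apply: le_trans (sum_layers_le K (ltW h0) (poweR_ge0 _ _)).
apply: lee_sum => i _; rewrite lee_wpmul2l ?lee_fin ?(ltW h0)// !indicE ler_nat.
case: (boolP (t \in _)) => //; rewrite inE/= in_itv/= => /andP[t0 tb].
rewrite mem_set//=.
have root0 : (0 <= i.+1%:R * h)%R by rewrite mulr_ge0// ltW.
(* The level is written as a power of exponent [s], because the rearrangement is that of [f] and not
   of its power. *)
have -> : (i.+1%:R * h)%:E = ((i.+1%:R * h) `^ s^-1)%:E `^ s.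
  by rewrite poweR_EFin -powRrM mulVf ?gt_eqF// powRr1.
apply: gt0_ler_poweR; rewrite ?(ltW s0)// ?in_itv/= ?leey ?andbT ?rearrangement_ge0//.
  by rewrite lee_fin powR_ge0.
apply: rearrangement_ge => //.
apply: (@lt_le_trans _ _ (mu (S i `&` A))); first by rewrite -bE lte_fin.
apply: le_measure; rewrite ?inE//; first exact: measurableI.
  exact: measurable_superlevel.
move=> x [/= Six _]; rewrite ltNge; apply/negP => h1; move: Six.
rewrite /S/= ltNge => /negP; apply.
have -> : (i.+1%:R * h)%:E = ((i.+1%:R * h) `^ s^-1)%:E `^ s.
  by rewrite poweR_EFin -powRrM mulVf ?gt_eqF// powRr1.
by apply: gt0_ler_poweR; rewrite ?(ltW s0)// ?in_itv/= ?leey ?andbT// lee_fin powR_ge0.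
Unshelve. all: by end_near. Qed.
End Rearrangement.

(** * Bounds for p-series *)

Section PSeries.
Context {R : realType}.

(** This follows from exp y >= 1 + y and ln(1 - 1/x) <= -1/x; it replaces the comparison of the
    series with an integral. *)
Lemma powR_neg_decrement (b x : R) : 0 < b -> 1 < x ->
  b * x `^ (- (b + 1)) <= (x - 1) `^ (- b) - x `^ (- b).
Proof.
move=> b0 x1; have x0 : 0 < x by exact: lt_trans x1.
have x10 : 0 < x - 1 by rewrite subr_gt0.
have -> : x `^ (- (b + 1)) = x `^ (- b) / x.
  rewrite opprD powRD; last by rewrite (gt_eqF x0) implybT.
  by rewrite powR_inv1// ltW.
have -> : (x - 1) `^ (- b) = x `^ (- b) * expR (- b * ln (1 + - x^-1)).
  have -> : 1 + - x^-1 = (x - 1) / x by rewrite mulrBl divff ?gt_eqF// mul1r.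
  rewrite /powR !gt_eqF// -expRD; congr expR.
  by rewrite ln_div// -mulrDr [ln x + _]addrC subrK.
rewrite mulrCA -[X in _ - X]mulr1 -mulrBr ler_wpM2l ?powR_ge0//.
rewrite lerBrDl; apply: le_trans (expR_ge1Dx _); rewrite lerD2l mulNr -mulrN.
rewrite ler_wpM2l ?(ltW b0)// lerNr; apply: le_ln1Dx.
by rewrite ltrN2 invf_lt1.
Qed.

Lemma sum_powR_bounded (a : R) (n : nat) : 1 < a ->
  \sum_(i < n) (i.+1%:R `^ (- a)) <= 1 + (a - 1)^-1.
Proof.
move=> a1; set b := a - 1; have b0 : 0 < b by rewrite subr_gt0.
have aE : a = b + 1 by rewrite subrK.
(* Carrying the tail term on the left makes the induction telescope. *)
suff h m : \sum_(i < m.+1) (i.+1%:R `^ (- a)) + b^-1 * m.+1%:R `^ (- b) <= 1 + b^-1.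
  case: n => [|n]; first by rewrite big_ord0 addr_ge0// invr_ge0 ltW.
  by apply: le_trans (h n); rewrite lerDl mulr_ge0 ?powR_ge0// invr_ge0 ltW.
elim: m => [|m IH]; first by rewrite big_ord1 !powR1 mulr1.
rewrite big_ord_recr/=; apply: le_trans IH; rewrite -addrA lerD2l.
have := @powR_neg_decrement b m.+2%:R b0; rewrite ltr1n => /(_ isT).
rewrite -(@ler_pM2l _ b^-1) ?invr_gt0// mulrA mulVf ?gt_eqF// mul1r mulrBr.
have -> : m.+2%:R - 1 = m.+1%:R :> R by rewrite -natr1 addrK.
by rewrite -aE lerBrDr.
Qed.

End PSeries.

Section Zygmund.
Context {d : measure_display} {R : realType} {P : metricMeasurableType d R}.
Context (mu : {measure set P -> \bar R}).
Local Open Scope ereal_scope.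
Implicit Types (f : P -> \bar R).

(** By [hardy_littlewood] this dominates the L^s norm of a measurable [f] over every measurable set
    of measure at most [a], wherever the set lies. *)
Definition rearrangement_norm (s : R) f (a : R) : \bar R :=
  (\int[lebesgue_measure]_(t in `]0%R, a[) (rearrangement mu f t `^ s)) `^ s^-1.

Definition log_weight (alpha m t : R) : R := (1 + ln (m / t)) `^ alpha.

Lemma ln_div_ge0 (m t : R) : (0 < t <= m)%R -> (0 <= ln (m / t))%R.
Proof. by move=> /andP[t0 tm]; rewrite ln_ge0// ler_pdivlMr// mul1r. Qed.

Lemma log_weight_ge1 (alpha m t : R) : (0 <= alpha)%R -> (0 < t <= m)%R ->
  (1 <= log_weight alpha m t)%R.
Proof.
move=> al tm; rewrite /log_weight.
apply: (@le_trans _ _ (1 `^ alpha)%R); first by rewrite powR1.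
by apply: ge0_ler_powR; rewrite ?nnegrE// ?addr_ge0 ?lerDl// ln_div_ge0.
Qed.

Lemma le_log_weight (alpha m m' t t' : R) : (0 <= alpha)%R -> (0 < t)%R ->
  (t <= t' <= m)%R -> (m <= m')%R -> (log_weight alpha m t' <= log_weight alpha m' t)%R.
Proof.
move=> al t0 /andP[tt' tm] mm'.
have t'0 : (0 < t')%R by exact: lt_le_trans tt'.
have m0 : (0 < m)%R by exact: lt_le_trans tm.
have m'0 : (0 < m')%R by exact: lt_le_trans mm'.
apply: ge0_ler_powR; rewrite ?nnegrE// ?addr_ge0 ?ln_div_ge0// ?t'0 ?t0//=.
  by rewrite (le_trans tt')// (le_trans tm).
rewrite lerD2l ler_ln ?posrE ?divr_gt0//.
by apply: ler_pM; rewrite ?invr_ge0 ?(ltW m0) ?(ltW t'0)// lef_pV2.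
Qed.

Lemma measurable_log_weight (alpha m : R) :
  measurable_fun `]0%R, m[ (EFin \o log_weight alpha m).
Proof.
apply/measurable_EFinP.
apply: (measurableT_comp (measurable_powR _)).
apply: measurable_funD => //.
apply: (eq_measurable_fun (fun t => ln m - ln t)%R).
  move=> t; rewrite inE/= in_itv/= => /andP[t0 tm].
  by rewrite ln_div// posrE//; exact: lt_trans tm.
apply: measurable_funB => //; apply: measurable_funTS; exact: measurable_ln.
Qed.

Lemma zygmund_normE (s alpha : R) E f : zygmund_norm mu s alpha E f =
  (\int[lebesgue_measure]_(t in `]0%R, fine (mu E)[)
    (rearrangement mu f t * (log_weight alpha (fine (mu E)) t)%:E) `^ s) `^ s^-1.
Proof. by []. Qed.

Lemma measurable_zygmund_integrand (s alpha m a : R) f : (a <= m)%R ->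
  measurable_fun `]0%R, a[
   (fun t => (rearrangement mu f t * (log_weight alpha m t)%:E) `^ s).
Proof.
move=> am; apply: (measurableT_comp (measurable_poweR _)).
apply: emeasurable_funM; first exact: measurable_rearrangement.
apply: (@measurable_funS _ _ _ _ `]0%R, m[%classic) => //.
  by apply: subset_itvl; rewrite bnd_simp.
exact: measurable_log_weight.
Qed.

Lemma le_poweR (s : R) (x y : \bar R) : (0 <= s)%R -> 0 <= x -> x <= y -> x `^ s <= y `^ s.
Proof.
move=> s0 x0 xy; apply: gt0_ler_poweR; rewrite ?in_itv/= ?leey ?andbT//.
exact: le_trans xy.
Qed.

(** A larger measure both increases the weight and lengthens the interval of integration. *)
Lemma le_zygmund_norm (s alpha : R) E E' f : (0 < s)%R -> (0 <= alpha)%R ->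
  (fine (mu E) <= fine (mu E'))%R ->
  zygmund_norm mu s alpha E f <= zygmund_norm mu s alpha E' f.
Proof.
move=> s0 al EE'; rewrite !zygmund_normE; apply: le_poweR.
- by rewrite invr_ge0 ltW.
- by apply: integral_ge0 => t _; exact: poweR_ge0.
apply: (@le_trans _ _ (\int[lebesgue_measure]_(t in `]0%R, fine (mu E)[)
    (rearrangement mu f t * (log_weight alpha (fine (mu E')) t)%:E) `^ s)).
  apply: ge0_le_integral; first exact: measurable_itv.
  - by move=> t _; exact: poweR_ge0.
  - exact: measurable_zygmund_integrand.
  - exact: measurable_zygmund_integrand.
  move=> t /=; rewrite in_itv/= => /andP[t0 tm]; apply: le_poweR => //.
  - exact: ltW.
  - by rewrite mule_ge0 ?rearrangement_ge0// lee_fin powR_ge0.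
  by rewrite lee_wpmul2l ?rearrangement_ge0// lee_fin le_log_weight// lexx ltW.
apply: ge0_subset_integral => //.
- exact: measurable_zygmund_integrand.
- by move=> t _; exact: poweR_ge0.
- by apply: subset_itvl; rewrite bnd_simp.
Qed.

(** The weight decreases in [t], so on []0, a[] it is at least its value at [a], which comes out of
    the norm. *)
Lemma rearrangement_norm_weight (s alpha : R) E f (a : R) : (0 < s)%R -> (0 <= alpha)%R ->
  (0 < a <= fine (mu E))%R ->
  rearrangement_norm s f a * (log_weight alpha (fine (mu E)) a)%:E <=
  zygmund_norm mu s alpha E f.
Proof.
move=> s0 al /andP[a0 am]; rewrite zygmund_normE /rearrangement_norm.
set m := fine (mu E) in am *; set w := log_weight alpha m a.
have w0 : (0 <= w)%R by exact: powR_ge0.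
have int_ge0 : 0 <= \int[lebesgue_measure]_(t in `]0%R, a[) (rearrangement mu f t `^ s).
  by apply: integral_ge0 => t _; exact: poweR_ge0.
have -> : w%:E = (w%:E `^ s) `^ s^-1.
  by rewrite -poweRrM divff ?gt_eqF// poweRe1.
rewrite -poweRM ?poweR_ge0//; apply: le_poweR.
- by rewrite invr_ge0 ltW.
- by rewrite mule_ge0 ?poweR_ge0.
rewrite muleC -ge0_integralZl//; last 3 first.
- apply: (measurableT_comp (measurable_poweR _)).
  exact: measurable_rearrangement.
- by move=> t _; exact: poweR_ge0.
- exact: poweR_ge0.
apply: (@le_trans _ _ (\int[lebesgue_measure]_(t in `]0%R, a[)
    (rearrangement mu f t * (log_weight alpha m t)%:E) `^ s)).
  apply: ge0_le_integral; first exact: measurable_itv.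
  - by move=> t _; rewrite mule_ge0 ?poweR_ge0.
  - apply: emeasurable_funM => //; apply: (measurableT_comp (measurable_poweR _)).
    exact: measurable_rearrangement.
  - exact: measurable_zygmund_integrand.
  move=> t /=; rewrite in_itv/= => /andP[t0 ta].
  rewrite -poweR_EFin muleC -poweRM ?rearrangement_ge0//; apply: le_poweR; first exact: ltW.
    by rewrite mule_ge0 ?rearrangement_ge0.
  by rewrite lee_wpmul2l ?rearrangement_ge0// lee_fin le_log_weight// (ltW ta).
apply: ge0_subset_integral => //.
- exact: measurable_zygmund_integrand.
- by move=> t _; exact: poweR_ge0.
- by apply: subset_itvl; rewrite bnd_simp.
Qed.

Lemma rearrangement_norm_ge0 (s : R) f (a : R) : 0 <= rearrangement_norm s f a.
Proof. exact: poweR_ge0. Qed.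

Lemma le_rearrangement_norm (s : R) f (a a' : R) : (0 < s)%R -> (a <= a')%R ->
  rearrangement_norm s f a <= rearrangement_norm s f a'.
Proof.
move=> s0 aa'; apply: le_poweR; first by rewrite invr_ge0 ltW.
  by apply: integral_ge0 => t _; exact: poweR_ge0.
apply: ge0_subset_integral => //.
- apply: (measurableT_comp (measurable_poweR _)).
  exact: measurable_rearrangement.
- by move=> t _; exact: poweR_ge0.
- by apply: subset_itvl; rewrite bnd_simp.
Qed.

Lemma rearrangement_norm_le_zygmund (s alpha : R) E f (a : R) : (0 < s)%R -> (0 <= alpha)%R ->
  (0 < a <= fine (mu E))%R ->
  rearrangement_norm s f a <= zygmund_norm mu s alpha E f.
Proof.
move=> s0 al am; apply: le_trans (rearrangement_norm_weight f s0 al am).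
rewrite -[leLHS]mule1 lee_wpmul2l ?rearrangement_norm_ge0// lee_fin.
exact: log_weight_ge1.
Qed.

End Zygmund.

(** * Summing rearrangement norms over halved measures *)

Section ZygmundSum.
Context {d : measure_display} {R : realType} {P : metricMeasurableType d R}.
Context (mu : {measure set P -> \bar R}).
Local Open Scope ereal_scope.

Lemma ln2_gt0 : (0 < ln 2 :> R)%R.
Proof. by rewrite ln_gt0// ltr1n. Qed.

Lemma ln2_le1 : (ln 2 <= 1 :> R)%R.
Proof. by apply: (@le_ln1Dx R 1); lra. Qed.

Lemma ln_mul_half (m : R) (i : nat) : (0 < m)%R ->
  ln (m / (m * 2 ^- i)) = (i%:R * ln 2)%R :> R.
Proof.
move=> m0; rewrite invfM invrK mulrA divff ?gt_eqF// mul1r lnXn//.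
by rewrite mulr_natl.
Qed.

Lemma count_halves (m t : R) (q : nat) : (0 < t < m)%R ->
  (\sum_(i < q) (t < m * 2 ^- i)%R%:R <= (ln 2)^-1 * (1 + ln (m / t)) :> R)%R.
Proof.
move=> /andP[t0 tm]; have m0 : (0 < m)%R by exact: lt_trans tm.
have l0 : (0 <= ln (m / t))%R by rewrite ln_div_ge0// t0 ltW.
elim: q => [|q IH].
  by rewrite big_ord0 mulr_ge0 ?invr_ge0 ?(ltW ln2_gt0)// addr_ge0.
rewrite big_ord_recr/=; case: (ltP t (m * 2 ^- q)%R) => tq; last by rewrite addr0.
(* Here [q] is counted, so [q * ln 2 <= ln (m / t)], and the trivial count [q + 1] suffices because
   [ln 2 <= 1]. *)
apply: (@le_trans _ _ (q.+1%:R)).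
  rewrite -[leRHS]natr1; apply: lerD => //; apply: (@le_trans _ _ (\sum_(i < q) 1)%R).
    by apply: ler_sum => i _; case: (_ < _)%R.
  by rewrite sumr_const card_ord.
rewrite -(@ler_pM2l _ (ln 2)) ?ln2_gt0// mulrA divff ?gt_eqF ?ln2_gt0// mul1r.
rewrite -[q.+1%:R]natr1 mulrDr mulr1 addrC; apply: lerD; first exact: ln2_le1.
rewrite mulrC -(ln_mul_half q m0) ler_ln ?posrE ?divr_gt0 ?mulr_gt0 ?invr_gt0 ?exprn_gt0//.
rewrite ler_pM2l// lef_pV2 ?posrE ?mulr_gt0 ?invr_gt0 ?exprn_gt0//.
exact: ltW.
Qed.

(** The base of the weight at [m * 2 ^- i] is 1 + i ln 2, at least (i + 1) ln 2 because ln 2 <= 1;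
    what remains is a p-series with exponent [alpha]. *)
Lemma sum_rearrangement_norm_gt1 (s alpha : R) : (0 < s)%R -> (1 < alpha)%R ->
  exists2 S : R, (0 < S)%R & forall (E : set P) (f : P -> \bar R) (q : nat),
    (0 < fine (mu E))%R ->
    \sum_(i < q) rearrangement_norm mu s f (fine (mu E) * 2 ^- i)%R <=
    S%:E * zygmund_norm mu s alpha E f.
Proof.
move=> s0 al; exists ((ln 2 `^ alpha)^-1 * (1 + (alpha - 1)^-1))%R.
  by rewrite mulr_gt0 ?invr_gt0 ?powR_gt0 ?ln2_gt0// addr_gt0// invr_gt0 subr_gt0.
move=> E f q; set m := fine (mu E) => m0; set Z := zygmund_norm _ _ _ _ _.
have al0 : (0 <= alpha)%R by exact: le_trans (ltW al).
have Z0 : 0 <= Z by exact: poweR_ge0.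
have term i : rearrangement_norm mu s f (m * 2 ^- i)%R <=
    ((ln 2 `^ alpha)^-1 * i.+1%:R `^ (- alpha))%:E * Z.
  have p2 : (0 < 2 ^- i :> R)%R by rewrite invr_gt0 exprn_gt0.
  have am : (0 < m * 2 ^- i <= m)%R.
    by rewrite mulr_gt0//= ger_pMr// invf_le1 ?exprn_gt0// exprn_ege1// ler1n.
  have h := rearrangement_norm_weight f s0 al0 am.
  rewrite -/m in h; set w := log_weight _ _ _ in h.
  have lw : (0 < 1 + ln (m / (m * 2 ^- i)))%R by rewrite ltr_wpDr// ln_div_ge0.
  have w0 : (0 < w)%R by apply: lt_le_trans (log_weight_ge1 al0 am).
  have -> : rearrangement_norm mu s f (m * 2 ^- i)%R =
      w^-1%:E * (rearrangement_norm mu s f (m * 2 ^- i)%R * w%:E).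
    by rewrite muleCA -EFinM mulVf ?gt_eqF// mule1.
  apply: (@le_trans _ _ (w^-1%:E * Z)).
    by rewrite lee_wpmul2l// lee_fin invr_ge0 ltW.
  rewrite lee_wpmul2r// lee_fin powRN -invfM lef_pV2 ?posrE ?mulr_gt0 ?powR_gt0 ?ln2_gt0//.
  rewrite -powRM ?(ltW ln2_gt0)// /w /log_weight ln_mul_half//.
  apply: ge0_ler_powR; rewrite ?nnegrE ?addr_ge0 ?mulr_ge0 ?(ltW ln2_gt0)//.
  by rewrite -[i.+1%:R]natr1 mulrDr mulr1 addrC mulrC lerD2r ln2_le1.
apply: le_trans (lee_sum _ (fun i _ => term _)) _.
rewrite -ge0_sume_distrl; last first.
  by move=> i _; rewrite lee_fin mulr_ge0 ?powR_ge0// invr_ge0 powR_ge0.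
rewrite lee_wpmul2r// sumEFin lee_fin -mulr_sumr ler_wpM2l ?invr_ge0 ?powR_ge0//.
exact: sum_powR_bounded.
Qed.

(** For exponent one the sum moves inside the integral, where it counts the [i] with
    [t < m * 2 ^- i]; by [count_halves] the weight pays for this count already at [alpha = 1]. *)
Lemma sum_rearrangement_norm_eq1 (alpha : R) : (1 <= alpha)%R ->
  forall (E : set P) (f : P -> \bar R) (q : nat),
    (0 < fine (mu E))%R ->
    \sum_(i < q) rearrangement_norm mu 1 f (fine (mu E) * 2 ^- i)%R <=
    (ln 2)^-1%:E * zygmund_norm mu 1 alpha E f.
Proof.
move=> al E f q; rewrite zygmund_normE; set m := fine (mu E) => m0.
rewrite invr1 poweRe1; last by apply: integral_ge0 => t _; exact: poweR_ge0.
have l2 : (0 <= (ln 2)^-1 :> R)%R by rewrite invr_ge0 ltW// ln2_gt0.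
rewrite -ge0_integralZl//; last 2 first.
- exact: measurable_zygmund_integrand.
- by move=> t _; exact: poweR_ge0.
have mr i : measurable_fun `]0%R, m[
    (fun t => rearrangement mu f t * (\1_(`]0%R, m * 2 ^- i[) t)%:E).
  apply: emeasurable_funM; first exact: measurable_rearrangement.
  by apply/measurable_EFinP; exact: measurable_indic.
have -> : \sum_(i < q) rearrangement_norm mu 1 f (m * 2 ^- i)%R =
    \int[lebesgue_measure]_(t in `]0%R, m[) (\sum_(i < q)
      rearrangement mu f t * (\1_(`]0%R, m * 2 ^- i[) t)%:E).
  rewrite ge0_integral_sum//; last 2 first.
  - by move=> i; exact: mr.
  - by move=> i t _; rewrite mule_ge0 ?rearrangement_ge0 ?lee_fin.
  apply: eq_bigr => i _; rewrite /rearrangement_norm invr1 poweRe1; last first.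
    by apply: integral_ge0 => t _; exact: poweR_ge0.
  have sub : `]0%R, (m * 2 ^- i)%R[%classic =
      `]0%R, m[%classic `&` `]0%R, (m * 2 ^- i)%R[%classic.
    apply/esym/setIidr; apply: subset_itvl; rewrite bnd_simp.
    by rewrite ger_pMr// invf_le1 ?exprn_gt0// exprn_ege1// ler1n.
  rewrite {1}sub integral_mkcondr; apply: eq_integral => t _.
  rewrite patchE indicE; case: ifPn => _; last by rewrite mule0.
  by rewrite mule1 poweRe1// rearrangement_ge0.
apply: ge0_le_integral; first exact: measurable_itv.
- by move=> t _; apply: sume_ge0 => i _; rewrite mule_ge0 ?rearrangement_ge0 ?lee_fin.
- by apply: emeasurable_sum => i; exact: mr.
- by apply: emeasurable_funM => //; exact: measurable_zygmund_integrand.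
move=> t /=; rewrite in_itv/= => /andP[t0 tm].
rewrite -ge0_sume_distrr; last by move=> i _; rewrite lee_fin.
rewrite poweRe1; last first.
  by rewrite mule_ge0 ?rearrangement_ge0// lee_fin powR_ge0.
rewrite muleCA lee_wpmul2l ?rearrangement_ge0// sumEFin -EFinM lee_fin.
apply: (@le_trans _ _ ((ln 2)^-1 * (1 + ln (m / t)))%R).
  have := @count_halves m t q; rewrite t0 tm => /(_ isT); apply: le_trans.
  apply: ler_sum => i _; rewrite indicE; case: (boolP (t \in _)) => //.
  by rewrite inE/= in_itv/= t0 => /= ->.
rewrite ler_wpM2l// /log_weight -[leLHS]powRr1; last first.
  by rewrite addr_ge0// ln_div_ge0// t0 ltW.
by rewrite ler_powR// lerDl ln_div_ge0// t0 ltW.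
Qed.

Lemma sum_rearrangement_norm (s alpha : R) : (1 <= s)%R ->
  (s = 1 -> 1 <= alpha)%R -> (1 < s -> 1 < alpha)%R ->
  exists2 S : R, (0 < S)%R & forall (E : set P) (f : P -> \bar R) (q : nat),
    (0 < fine (mu E))%R ->
    \sum_(i < q) rearrangement_norm mu s f (fine (mu E) * 2 ^- i)%R <=
    S%:E * zygmund_norm mu s alpha E f.
Proof.
rewrite le_eqVlt => /predU1P[<-|s1] h1 h2.
  exists (ln 2)^-1%R; first by rewrite invr_gt0 ln2_gt0.
  by move=> E f q; apply: sum_rearrangement_norm_eq1; exact: h1.
by apply: sum_rearrangement_norm_gt1; [exact: lt_trans s1|exact: h2].
Qed.

End ZygmundSum.

(** * Weak upper gradients *)

(** The integral of a nonnegative function is a supremum over simple functions below it, so it is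
    monotone on arbitrary functions. Weak upper gradients along curves call for this generality. *)
Lemma ge0_le_integral_nonmeasurable {d} {T : measurableType d} {R : realType}
    (mu : {measure set T -> \bar R}) (D : set T) (f g : T -> \bar R) :
  (forall x, D x -> 0 <= f x)%E -> (forall x, D x -> f x <= g x)%E ->
  (\int[mu]_(x in D) f x <= \int[mu]_(x in D) g x)%E.
Proof.
move=> f0 fg; rewrite !ge0_integralE//; last first.
  by move=> x Dx; apply: le_trans (fg x Dx); exact: f0.
apply: ereal_sup_le => _ [h /= hf <-]; exists h => //= x.
by apply: le_trans (hf x) _; exact: lee_restrict.
Qed.

Section BorelMajorant.
Context {d : measure_display} {R : realType} {P : metricMeasurableType d R}.
Context (mu : {measure set P -> \bar R}).
Local Open Scope ereal_scope.
Hypothesis Hmu : borel_regular_measure mu.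

Lemma bigcup_ball (x : P) : \bigcup_n ball x n.+1%:R = [set: P].
Proof.
apply/seteqP; split => // y _; exists (Num.truncn (mdist x y)) => //.
by rewrite ballEmdist/= truncnS_gt.
Qed.

(** Regularity gives a Borel superset of equal measure, which makes the difference null only when
    that measure is finite; hence [A] is first cut by balls. *)
Lemma borel_envelope (x : P) (A : set P) : measurable A ->
  exists2 D, borel_set D & A `<=` D /\ mu.-negligible (D `\` A).
Proof.
move=> mA.
have mB n : measurable (ball x n.+1%:R).
  by apply: (brm_borel Hmu); apply: sub_sigma_algebra; exact: metric_ball_open.
have /choice[D HD] : forall n, exists D : set P,
    [/\ borel_set D, A `&` ball x n.+1%:R `<=` D & mu D = mu (A `&` ball x n.+1%:R)].
  move=> n; have [D bD [AD DE]] := brm_regular Hmu (measurableI _ _ mA (mB n)).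
  by exists D.
exists (\bigcup_n D n).
  by apply: sigma_algebra_bigcup => n; have [] := HD n.
split.
  move=> y Ay; have : (\bigcup_n ball x n.+1%:R) y by rewrite bigcup_ball.
  by move=> [n _ By]; exists n => //; have [_ + _] := HD n; apply.
have sub : \bigcup_n D n `\` A `<=` \bigcup_n (D n `\` (A `&` ball x n.+1%:R)).
  by move=> y [[n _ Dny] nAy]; exists n => //; split => // -[].
apply: (negligibleS sub).
apply: negligible_bigcup => n; have [bD AD DE] := HD n.
have mD := brm_borel Hmu bD; have mAB := measurableI _ _ mA (mB n).
apply/negligibleP; first exact: measurableD.
have muD : mu (D n) < +oo.
  rewrite DE; apply: (@le_lt_trans _ _ (mu (ball x n.+1%:R))).
    by apply: le_measure; rewrite ?inE//; apply: subIsetr.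
  by have /andP[] := @brm_ball _ _ _ _ Hmu x n.+1%:R (ltr0Sn _ _).
apply: etrans (measureD mD mAB muD) _.
by rewrite (setIidr AD) -[X in _ - X]DE subee// ge0_fin_numE.
Qed.

(* The majorant is one everywhere: along a curve, [g] may fail to be measurable
   and need not agree with a function that is equal to it almost everywhere. *)
Lemma borel_majorant (x : P) (g : P -> \bar R) : measurable_fun setT g ->
  (forall y, 0 <= g y) ->
  exists g' : P -> \bar R, [/\ borel_fun g', forall y, g y <= g' y &
    {ae mu, forall y, g' y = g y}].
Proof.
move=> mg g0.
have /choice[D HD] : forall q : rat, exists D : set P,
    [/\ borel_set D, [set y | (ratr q)%:E < g y] `<=` D &
      mu.-negligible (D `\` [set y | (ratr q)%:E < g y])].
  move=> q; have [|D bD [AD nD]] := borel_envelope x (A := [set y | (ratr q)%:E < g y]).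
    rewrite -[X in measurable X]setTI; exact: emeasurable_fun_o_infty.
  by exists D.
(* The majorant is the supremum of the functions q 1_{D q}, enumerated through [unpickle]; codes of
   no rational give 0, which is below [g]. *)
pose u (k : nat) (y : P) : \bar R :=
  if unpickle k is Some q then (ratr q)%:E * (\1_(D q) y)%:E else 0.
have mu_ k : borel_fun (u k).
  rewrite /u; case: (unpickle k) => [q|]; last exact: measurable_cst.
  apply: emeasurable_funM; first exact: measurable_cst.
  apply/measurable_EFinP; apply: measurable_indic.
  by have [] := HD q.
have ge_g y : g y <= esups (u ^~ y) 0%N.
  rewrite leNgt; apply/negP => lt_g.
  have g'0 : 0 <= esups (u^~ y) 0%N.
    apply: (@le_trans _ _ (u (pickle (0%R : rat)) y)).
      by rewrite /u pickleK rmorph0 mul0e.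
    by apply: ereal_sup_ubound; exists (pickle (0%R : rat)).
  have [q /andP[q1 q2]] : exists q : rat, esups (u^~ y) 0%N < (ratr q)%:E < g y.
    move: lt_g g'0; case: (esups _ _) => [r||]//.
    + case: (g y) => [v||]//.
      * rewrite lte_fin => rv _; have [q] := rat_in_itvoo rv.
        by rewrite in_itv/= => h; exists q; rewrite !lte_fin.
      * have r1 : (r < r + 1)%R by rewrite ltrDl.
        move=> _ _; have [q] := rat_in_itvoo r1.
        by rewrite in_itv/= => /andP[h _]; exists q; rewrite lte_fin h ltry.
    + by case: (g y).
  move: q1; rewrite ltNge => /negP; apply.
  apply: (@le_trans _ _ (u (pickle q) y)).
    have [_ + _] := HD q => /(_ y q2) Dqy.
    by rewrite /u pickleK indicE mem_set ?mule1.
  by apply: ereal_sup_ubound; exists (pickle q).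
exists (fun y => esups (u ^~ y) 0%N); split => //.
  exact: measurable_fun_esups.
(* Outside this null union every [u k] is at most [g]. *)
have : mu.-negligible (\bigcup_k (if unpickle k is Some q then
    D q `\` [set y | (ratr q)%:E < g y] else set0)).
  apply: negligible_bigcup => k; case: (unpickle k) => [q|].
    by have [] := HD q.
  exact: negligible_set0.
apply: negligibleS => y; apply: contra_notP => notN /=.
have le : esups (u ^~ y) 0%N <= g y.
  apply: ge_ereal_sup => _ [k _ <-]; rewrite /u.
  case E : (unpickle k) => [q|]; last exact: g0.
  rewrite indicE; case: (boolP (y \in D q)); rewrite ?mule0 ?mule1// inE => Dqy.
  rewrite leNgt; apply/negP => gq; apply: notN; exists k => //=; rewrite E.
  by split => //=; apply/negP; rewrite -leNgt ltW.
apply/eqP; rewrite eq_le le/=; exact: ge_g.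
Qed.
End BorelMajorant.

Section WeakUpperGradients.
Context {d : measure_display} {R : realType} {P : metricMeasurableType d R}.
Context (mu : {measure set P -> \bar R}) (nrm : (P -> \bar R) -> \bar R).
Local Open Scope ereal_scope.
Hypothesis Hmu : borel_regular_measure mu.

(** Along exceptional curves [e * rho] alone has infinite integral; along the others the inequality
    passes from [g] to [g'], which lies above [g] at every point. *)
Lemma weak_upper_gradient_approx (x : P) (u g : P -> \bar R) :
  weak_upper_gradient nrm u g ->
  exists g' rho : P -> \bar R, [/\ borel_fun g', forall y, 0 <= g' y,
    {ae mu, forall y, g' y = g y}, [/\ borel_fun rho, forall y, 0 <= rho y &
    in_lattice nrm rho] &
    forall e : R, (0 < e)%R -> upper_gradient u (fun y => g' y + e%:E * rho y)].
Proof.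
move=> [mg g0 [Gamma [rho [brho rho0 rhoX rhoG]] ugG]].
have [g' [bg' gg' g'g]] := borel_majorant Hmu x mg g0.
have g'0 y : 0 <= g' y by exact: le_trans (g0 y) (gg' y).
exists g', rho; split => // e e0.
have erho0 y : 0 <= e%:E * rho y by rewrite mule_ge0// lee_fin ltW.
have berho : borel_fun (fun y => e%:E * rho y).
  by apply: emeasurable_funM => //; exact: measurable_cst.
split.
- exact: emeasurable_funD.
- by move=> y; exact: adde_ge0.
move=> gamma; have [Gg|nGg] := pselect (Gamma gamma).
  rewrite /upper_gradient_along.
  suff -> : curve_integral gamma (fun y => g' y + e%:E * rho y) = +oo by rewrite leey.
  apply/eqP; rewrite -leye_eq.
  have -> : +oo = curve_integral gamma (fun y => e%:E * rho y).
    rewrite /curve_integral ge0_integralZl//.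
    - by have := rhoG _ Gg; rewrite /curve_integral => ->; rewrite gt0_muley// lte_fin.
    - exact: borel_fun_curve.
    - by rewrite lee_fin ltW.
  by apply: ge0_le_integral_nonmeasurable => t _ //; rewrite leeDr.
apply: le_trans (ugG _ nGg) _.
apply: ge0_le_integral_nonmeasurable => t _ //.
by apply: le_trans (gg' _) _; rewrite leeDl.
Qed.

End WeakUpperGradients.

(** * Oscillation estimates *)

Section Averages.
Context {d : measure_display} {R : realType} {P : metricMeasurableType d R}.
Context (mu : {measure set P -> \bar R}).
Hypothesis Hmu : borel_regular_measure mu.
Implicit Types (u : P -> \bar R) (B : set P) (x y z : P).

Local Notation vol z r := (fine (mu (ball z r))).

Lemma measurable_metric_ball x (r : R) : measurable (ball x r).
Proof. exact/(measurable_open Hmu)/metric_ball_open. Qed.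

Lemma volE x (r : R) : 0 < r -> mu (ball x r) = (vol x r)%:E.
Proof.
move=> r0; have /andP[h1 h2] := @brm_ball _ _ _ _ Hmu x r r0.
by rewrite fineK// ge0_fin_numE.
Qed.

Lemma vol_gt0 x (r : R) : 0 < r -> 0 < vol x r.
Proof.
move=> r0; have /andP[h1 h2] := @brm_ball _ _ _ _ Hmu x r r0.
by rewrite fine_gt0// h1.
Qed.

Lemma subset_metric_ball x y (r r' : R) : mdist x y + r <= r' ->
  ball y r `<=` ball x r'.
Proof.
move=> h z; rewrite !ballEmdist/= => yz.
by apply: le_lt_trans (metric_triangle _ y _) _; apply: lt_le_trans h; rewrite ltrD2l.
Qed.

Lemma le_vol x y (r r' : R) : 0 < r -> 0 < r' -> ball x r `<=` ball y r' ->
  vol x r <= vol y r'.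
Proof.
move=> r0 r'0 sub; rewrite -lee_fin -!volE//.
by apply: le_measure; rewrite ?inE//; exact: measurable_metric_ball.
Qed.

(** Solved for the larger volume, the dimension condition becomes a doubling inequality for [k = 2]
    and controls dilated balls for [k = lambda]. *)
Lemma dimension_vol (s cs : R) : 0 < cs -> 0 <= s ->
  (forall (x y : P) (r r' : R), 0 < r <= r' -> ball x r' y ->
    cs * (r / r') `^ s <= vol y r / vol x r') ->
  forall x y (r k : R), 0 < r -> 1 <= k -> ball x (k * r) y ->
    vol x (k * r) <= k `^ s / cs * vol y r.
Proof.
move=> cs0 s0 dim x y r k r0 k1 xy; have k0 : 0 < k by exact: lt_le_trans k1.
have := dim x y r (k * r); rewrite r0 ler_peMl ?(ltW r0)// => /(_ isT xy).
rewrite ler_pdivlMr ?vol_gt0 ?mulr_gt0//.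
have -> : r / (k * r) = k^-1 by rewrite invfM mulrCA divff ?mulr1 ?gt_eqF.
rewrite -powR_inv1 ?(ltW k0)// -powRrM mulN1r powRN mulrAC ler_pdivrMr ?powR_gt0// => h.
by rewrite mulrAC ler_pdivlMr// mulrC [leRHS]mulrC.
Qed.

Lemma diam_ball x (r : R) : 0 < r -> (diam (ball x r) <= (2 * r)%:E)%E.
Proof.
move=> r0; apply: ge_ereal_sup => _ [[y z] [/= xy xz] <-]; rewrite lee_fin.
move: xy xz; rewrite !ballEmdist/= => xy xz.
apply: (le_trans (metric_triangle _ x _)).
by rewrite metric_sym mulr_natl mulr2n lerD// ltW.
Qed.

Local Open Scope ereal_scope.

Lemma average_ge0 B u : (forall x, B x -> 0 <= u x) -> 0 <= average mu B u.
Proof.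
move=> u0; rewrite mule_ge0 ?integral_ge0// lee_fin invr_ge0 fine_ge0//.
Qed.

Lemma average_fin B u : mu.-integrable B u -> measurable B ->
  average mu B u \is a fin_num.
Proof. by move=> iu mB; rewrite fin_numM// integrable_fin_num. Qed.

(** The constant moves inside the average over [B']; enlarging the domain to [B] then costs the
    ratio of the measures. *)
Lemma average_subset_dist B' B u (c : R) : measurable B' -> measurable B -> B' `<=` B ->
  0 < mu B' -> mu B < +oo -> mu.-integrable B u ->
  `|average mu B' u - c%:E| <=
   (fine (mu B) / fine (mu B'))%:E * average mu B (fun y => `|u y - c%:E|).
Proof.
move=> mB' mB sub B'0 Boo iu.
have BB' : mu B' <= mu B by apply: le_measure; rewrite ?inE.
have fB : mu B \is a fin_num by rewrite ge0_fin_numE.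
have fB' : mu B' \is a fin_num by rewrite ge0_fin_numE// (le_lt_trans BB').
have b'0 : (0 < fine (mu B'))%R by rewrite fine_gt0// B'0 (le_lt_trans BB').
have b0 : (0 < fine (mu B))%R by rewrite fine_gt0// Boo (lt_le_trans B'0).
have iu' : mu.-integrable B' u by exact: integrableS iu.
have ic : mu.-integrable B' (cst c%:E).
  apply/integrableP; split; first exact: measurable_cst.
  rewrite (eq_integral (cst `|c|%:E))// integral_cst//.
  by rewrite lte_mul_pinfty// (le_lt_trans BB').
have -> : average mu B' u - c%:E =
    (fine (mu B'))^-1%:E * \int[mu]_(y in B') (u y - c%:E).
  rewrite integralB// integral_cst// muleBr ?fin_num_adde_defl//; last first.
    by rewrite -[mu B']fineK// -EFinM.
  rewrite /average; congr (_ - _).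
  by rewrite -[mu B' in RHS]fineK// -!EFinM mulrCA mulVf ?gt_eqF// mulr1.
rewrite abseM /average muleA -EFinM gee0_abs ?lee_fin ?invr_ge0 ?(ltW b'0)//.
rewrite mulrAC divff ?gt_eqF// mul1r lee_wpmul2l ?lee_fin ?invr_ge0 ?(ltW b'0)//.
have mu_ : measurable_fun B u by exact: measurable_int iu.
have mabs : measurable_fun B (fun y => `|u y - c%:E|).
  by apply: measurableT_comp => //; exact: emeasurable_funB.
apply: le_trans (le_abse_integral _ mB' _) _.
  by apply: emeasurable_funB => //; exact: measurable_funS mu_.
exact: ge0_subset_integral.
Qed.

End Averages.

(** * Finite nets in balls *)

Section Nets.
Context {d : measure_display} {R : realType} {P : metricMeasurableType d R}.
Context (mu : {measure set P -> \bar R}).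
Hypothesis Hmu : borel_regular_measure mu.
Local Notation vol z r := (fine (mu (ball z r))).

Lemma net_vol_le (x : P) (r e : R) (l : seq P) : 0 < e -> e <= r ->
  (forall z, z \in l -> ball x r z) ->
  mu (\big[setU/set0]_(z <- l) ball z e) = (\sum_(z <- l) vol z e)%:E ->
  \sum_(z <- l) vol z e <= vol x (2 * r).
Proof.
move=> e0 er lB lE; have r0 : 0 < r by exact: lt_le_trans er.
rewrite -lee_fin -lE -(volE Hmu) ?mulr_gt0//; apply: le_measure; rewrite ?inE.
- by apply: bigsetU_measurable => z _; exact: (measurable_metric_ball Hmu).
- exact: (measurable_metric_ball Hmu).
move=> y; rewrite -bigcup_seq => -[z /= zl ezy].
have := lB z zl; rewrite ballEmdist/= => xz.
apply: subset_metric_ball ezy; rewrite mulr_natl mulr2n.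
by rewrite lerD// ltW.
Qed.

(** Without a net, separated lists could be extended forever, although each ball of radius [rho / 2]
    takes at least [c] from the volume of the doubled ball. *)
Lemma exists_net (x : P) (r rho c : R) : 0 < rho -> rho <= r -> 0 < c ->
  (forall z, ball x r z -> c <= vol z (rho / 2)) ->
  exists l : seq P, [/\ forall z, z \in l -> ball x r z,
    forall y, ball x r y -> exists2 z, z \in l & ball z rho y &
    \sum_(z <- l) vol z (rho / 2) <= vol x (2 * r)].
Proof.
move=> rho0 rhor c0 cv; set e := rho / 2.
have e0 : 0 < e by rewrite divr_gt0.
have er : e <= r by rewrite (le_trans _ rhor)// ler_pdivrMr// ler_peMr ?ler1n// ltW.
have r0 : 0 < r by exact: lt_le_trans rhor.
(* Disjointness of the small balls is recorded as additivity of their measures, the form that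
   [net_vol_le] takes. *)
pose separated (l : seq P) := (forall z, z \in l -> ball x r z) /\
  mu (\big[setU/set0]_(z <- l) ball z e) = (\sum_(z <- l) vol z e)%:E.
apply: contrapT => no_net.
have grow n : exists2 l : seq P, size l = n & separated l.
  elim: n => [|n [l ln [lB lE]]].
    by exists [::] => //; split; rewrite ?big_nil ?measure0.
  have [y xy ynl] : exists2 y, ball x r y & forall z, z \in l -> ~ ball z rho y.
    apply: contrapT => h; apply: no_net; exists l; split => //; last exact: net_vol_le.
    move=> y xy; apply: contrapT => h'; apply: h; exists y => // z zl zy.
    by apply: h'; exists z.
  exists (y :: l); first by rewrite /= ln.
  split; first by move=> z; rewrite inE => /predU1P[->//|]; exact: lB.
  rewrite !big_cons measureU//.
  - by rewrite EFinD; congr (_ + _)%E; [exact: (volE Hmu)|exact: lE].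
  - exact: (measurable_metric_ball Hmu).
  - by apply: bigsetU_measurable => z _; exact: (measurable_metric_ball Hmu).
  apply/seteqP; split => // w []; rewrite -bigcup_seq => yw [z /= zl zw].
  apply: (ynl z zl); move: yw zw; rewrite !ballEmdist/= => yw zw.
  apply: le_lt_trans (metric_triangle _ w _) _; rewrite (splitr rho).
  by apply: ltrD; rewrite // metric_sym.
have [l ln [lB lE]] := grow (Num.truncn (vol x (2 * r) / c)).+1.
have := net_vol_le e0 er lB lE; rewrite leNgt => /negP; apply.
apply: (@lt_le_trans _ _ (\sum_(z <- l) c)); last first.
  by rewrite big_seq [leRHS]big_seq; apply: ler_sum => z zl; exact/cv/lB.
by rewrite big_const_seq count_predT iter_addr_0 ln -[c *+ _]mulr_natl -ltr_pdivrMr// truncnS_gt.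
Qed.

End Nets.

(** * Telescoping along halved volumes *)

Section Chaining.
Context {R : realType}.

(* Consecutive indices along which [V] stays comparable are skipped, so that
   [V] is at least halved at each retained index; this replaces a reverse
   doubling condition. *)
Lemma chain_bound (v osc V psi : nat -> R) (D S : R) : 1 <= D ->
  (forall i, 0 < V i) -> (forall i j, (i <= j)%N -> V j <= V i) ->
  (forall i, V i <= D * V i.+1) ->
  (forall i j, (i <= j)%N -> `|v j - v i| <= V i / V j * osc i) ->
  (forall i q, V i <= V 0%N * 2 ^- q -> osc i <= psi q) ->
  (forall q, 0 <= psi q) ->
  (forall q : nat, \sum_(j < q) psi j <= S) ->
  forall n, `|v n - v 0%N| <= 2 * D * S.
Proof.
move=> D1 V0 Vni VD Hv Hosc psi0 HS n.
have D0 : 0 < D by exact: lt_le_trans D1.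
have osc0 i : 0 <= osc i.
  have := Hv i i (leqnn _); rewrite subrr normr0 divff ?gt_eqF// mul1r.
  by [].
(* [i] is the last retained index and [q] the number of retained steps; the oscillation at [i] is
   still to be paid. *)
have [q [i [ni Viq Vin Hi]]] : exists q i : nat, [/\ (i <= n)%N,
    V i <= V 0%N * 2 ^- q, V i <= 2 * V n &
    `|v i - v 0%N| <= 2 * D * \sum_(j < q) psi j].
  elim: n => [|n [q [i [ni Viq Vin Hi]]]].
    exists 0%N, 0%N; split => //.
    - by rewrite expr0 invr1 mulr1.
    - by rewrite ler_peMl ?ler1n// ltW.
    - by rewrite subrr normr0 big_ord0 mulr0.
  have [le2|gt2] := leP (V i) (2 * V n.+1).
    by exists q, i; split => //; exact: leqW.
  (* The volume has more than halved, so [n.+1] is retained. The step from [i] costs the ratio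
     [V i / V n.+1], at most [2 * D] because [V i <= 2 * V n]. *)
  exists q.+1, n.+1; split => //.
  - rewrite exprSr invfM mulrA ler_pdivlMr// mulrC.
    exact: le_trans (ltW gt2) Viq.
  - by rewrite ler_peMl ?ler1n// ltW.
  rewrite big_ord_recr/= mulrDr.
  have -> : v n.+1 - v 0%N = (v i - v 0%N) + (v n.+1 - v i) by ring.
  apply: (le_trans (ler_normD _ _)); apply: lerD Hi _.
  apply: (le_trans (Hv _ _ (leqW ni))).
  apply: ler_pM => //; first by rewrite divr_ge0 ?ltW.
    rewrite ler_pdivrMr// -mulrA; apply: (le_trans Vin).
    by rewrite ler_wpM2l.
  exact: Hosc.
(* The pending step from the last retained index to [n] adds the term of index [q]. *)
apply: (@le_trans _ _ (2 * D * \sum_(j < q.+1) psi j)); last first.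
  by rewrite ler_wpM2l// mulr_ge0// ltW.
rewrite big_ord_recr/= mulrDr.
have -> : v n - v 0%N = (v i - v 0%N) + (v n - v i) by ring.
apply: (le_trans (ler_normD _ _)); apply: lerD Hi _.
apply: (le_trans (Hv _ _ ni)).
apply: ler_pM => //; first by rewrite divr_ge0 ?ltW.
  rewrite ler_pdivrMr//; apply: (le_trans Vin).
  by rewrite (ler_wpM2r (ltW (V0 n)))// ler_peMr.
exact: Hosc.
Qed.

(** Truncated subtraction makes the first [N] terms equal to [h 0]. *)
Lemma sum_shift_le (h : nat -> R) (N Q : nat) : (forall i, 0 <= h i) ->
  \sum_(q < Q) h (q - N)%N <= N%:R * h 0%N + \sum_(i < Q) h i.
Proof.
move=> h0; apply: (@le_trans _ _ (\sum_(q < N + Q) h (q - N)%N)).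
  rewrite -(big_mkord xpredT (fun q => h (q - N)%N)).
  rewrite -(big_mkord xpredT (fun q => h (q - N)%N)).
  rewrite [leRHS](@big_cat_nat _ _ _ Q)//= ?leq_addl// lerDl.
  exact: sumr_ge0.
rewrite big_split_ord/=; apply: lerD.
  rewrite (eq_bigr (fun=> h 0%N)).
    by rewrite sumr_const card_ord mulr_natl.
  by move=> i _; congr h; apply/eqP; rewrite subn_eq0 ltnW.
by rewrite le_eqVlt; apply/orP; left; apply/eqP; apply: eq_bigr => i _; rewrite addKn.
Qed.

End Chaining.

Lemma powR_inv (R : realType) (v t : R) : 0 <= v -> v^-1 `^ t = v `^ (- t).
Proof. by move=> v0; rewrite -powR_inv1// -powRrM mulN1r. Qed.

(** * Oscillation of a function with an upper gradient *)

Section Oscillation.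
Context {d : measure_display} {R : realType} {P : metricMeasurableType d R}.
Context (mu : {measure set P -> \bar R}) (s lambda cPI cs : R).
Hypothesis Hmu : borel_regular_measure mu.
Hypothesis s1 : 1 <= s.
Hypothesis lambda1 : 1 <= lambda.
Hypothesis cPI0 : 0 < cPI.
Hypothesis cs0 : 0 < cs.
Hypothesis Hpoincare : forall (x : P) (r : R) u g, 0 < r ->
  (forall y r', 0 < r' -> mu.-integrable (ball y r') u) ->
  upper_gradient u g ->
  (average mu (ball x r) (fun y => `|u y - average mu (ball x r) u|) <=
   cPI%:E * diam (ball x r) *
   average mu (ball x (lambda * r)) (fun y => g y `^ s) `^ s^-1)%E.
Hypothesis Hdim : forall (x y : P) (r r' : R),
  0 < r <= r' -> ball x r' y ->
  cs * (r / r') `^ s <= fine (mu (ball y r)) / fine (mu (ball x r')).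

Local Notation vol z r := (fine (mu (ball z r))).
Local Notation osc u z r :=
  (average mu (ball z r) (fun y => `|u y - average mu (ball z r) u|)%E).

Let s0 : 0 < s. Proof. exact: lt_le_trans s1. Qed.
Let lambda0 : 0 < lambda. Proof. exact: lt_le_trans lambda1. Qed.

Lemma average_ball_dist (u : P -> \bar R) (x z : P) (r r' : R) :
  0 < r -> 0 < r' -> ball z r' `<=` ball x r -> mu.-integrable (ball x r) u ->
  ((`|fine (average mu (ball z r') u) - fine (average mu (ball x r) u)|)%:E <=
    (vol x r / vol z r')%:E * osc u x r)%E.
Proof.
move=> r0 r'0 sub iu.
have mx := measurable_metric_ball Hmu x r.
have mz := measurable_metric_ball Hmu z r'.
have iu' : mu.-integrable (ball z r') u by exact: integrableS iu.
have fx := average_fin iu mx; have fz := average_fin iu' mz.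
have [z0 _] := andP (brm_ball Hmu z r'0); have [_ xoo] := andP (brm_ball Hmu x r0).
have := average_subset_dist (fine (average mu (ball x r) u)) mz mx sub z0 xoo iu.
rewrite fineK// -[in X in (`|X - _| <= _)%E -> _](fineK fz).
by rewrite -[in X in (`|_ - X| <= _)%E -> _](fineK fx).
Qed.

Section FixedBall.
Context (u G : P -> \bar R) (x : P) (r : R).
Hypothesis r0 : 0 < r.
Hypothesis iu : forall y r', 0 < r' -> mu.-integrable (ball y r') u.
Hypothesis uG : upper_gradient u G.

Local Notation Bhat := (ball x (2 * lambda * r)).
Local Notation RN a := (rearrangement_norm mu s (G \_ Bhat) a).

Let rhat0 : 0 < 2 * lambda * r. Proof. by rewrite !mulr_gt0. Qed.

(** The Poincare inequality leads to the L^s norm over the dilated ball, which [hardy_littlewood]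
    bounds in terms of the volume of that ball. *)
Lemma osc_le_rearrangement (z : P) (rho a : R) : 0 < rho ->
  ball z (lambda * rho) `<=` Bhat -> vol z (lambda * rho) <= a ->
  (osc u z rho <=
   (cPI * (2 * rho) * vol z (lambda * rho) `^ (- s^-1))%:E * RN a)%E.
Proof.
move=> rho0 sub va; have lrho0 : 0 < lambda * rho by rewrite mulr_gt0.
have V0 := vol_gt0 Hmu z lrho0.
have [bG G0 _] := uG; have mG := borel_fun_measurable Hmu bG.
apply: (le_trans (Hpoincare z rho0 iu uG)).
have HL : (\int[mu]_(y in ball z (lambda * rho)) (G y `^ s) <=
  \int[lebesgue_measure]_(t in `]0%R, a[) (rearrangement mu (G \_ Bhat) t `^ s))%E.
  have mf : measurable_fun setT (G \_ Bhat).
    apply/(measurable_restrictT _ _).1; first exact: (measurable_metric_ball Hmu).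
    exact: measurable_funTS.
  apply: le_trans (hardy_littlewood s0 mf (measurable_metric_ball Hmu z _) _).
    rewrite (@eq_integral _ _ _ _ _ (fun y => (`|(G \_ Bhat) y| `^ s)%E)) ?lexx//.
    by move=> y /[!inE] yB; rewrite patchE mem_set ?gee0_abs//; exact: sub.
  by rewrite (volE Hmu)// lee_fin.
have int_ge0 : (0 <= \int[mu]_(y in ball z (lambda * rho)) (G y `^ s))%E.
  by apply: integral_ge0 => y _; exact: poweR_ge0.
rewrite [in leLHS]/average poweRM ?lee_fin ?invr_ge0 ?(ltW V0)//.
rewrite poweR_EFin powR_inv ?(ltW V0)//.
rewrite muleA; apply: lee_pmul.
- rewrite mule_ge0 ?lee_fin ?powR_ge0// mule_ge0 ?lee_fin ?(ltW cPI0)//.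
  apply: (@le_trans _ _ (mdist z z)%:E); first by rewrite mdistxx.
  by apply: ereal_sup_ubound; exists (z, z) => //; split; exact: ballxx.
- exact: poweR_ge0.
- rewrite EFinM lee_wpmul2r ?lee_fin ?powR_ge0// EFinM lee_wpmul2l ?lee_fin ?(ltW cPI0)//.
  exact: diam_ball.
- by apply: le_poweR => //; rewrite invr_ge0 ltW.
Qed.

(** With [k = 2 * r / rho], the dimension condition loses a factor of order k^s in volume, that is
    [k] after the root. This cancels [rho], so that all scales share one factor. *)
Lemma radius_volume_scale (z : P) (rho : R) : 0 < rho <= 2 * r -> Bhat z ->
  rho * vol z (lambda * rho) `^ (- s^-1) <=
  2 * cs `^ (- s^-1) * (r / vol x (2 * lambda * r) `^ s^-1).
Proof.
move=> /andP[rho0 rhor] zB.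
have lrho0 : 0 < lambda * rho by rewrite mulr_gt0.
have V0 := vol_gt0 Hmu z lrho0; have m0 := vol_gt0 Hmu x rhat0.
have k1 : 1 <= 2 * r / rho by rewrite ler_pdivlMr// mul1r.
have k0 : 0 < 2 * r / rho by exact: lt_le_trans k1.
have kE : 2 * lambda * r = 2 * r / rho * (lambda * rho).
  by field; rewrite gt_eqF.
have zB' := zB; rewrite kE in zB'.
have := dimension_vol Hmu cs0 (ltW s0) Hdim lrho0 k1 zB'; rewrite -kE => h.
have inv0 : 0 <= s^-1 by rewrite invr_ge0 ltW.
have : vol x (2 * lambda * r) `^ s^-1 <=
    2 * r / rho * cs `^ (- s^-1) * vol z (lambda * rho) `^ s^-1.
  apply: le_trans (ge0_ler_powR inv0 _ _ h) _.
  - by rewrite nnegrE ltW.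
  - by rewrite nnegrE mulr_ge0 ?(ltW V0)// divr_ge0 ?powR_ge0// ltW.
  rewrite powRM ?(ltW V0)//; last by rewrite divr_ge0 ?powR_ge0// ltW.
  rewrite powRM ?powR_ge0 ?invr_ge0 ?(ltW cs0)// -powRrM divff ?gt_eqF// powRr1 ?(ltW k0)//.
  by rewrite powR_inv// ltW.
set m' := vol x _ `^ _; set V' := vol z _ `^ _ => h'.
have m'0 : 0 < m' by rewrite powR_gt0.
have V'0 : 0 < V' by rewrite powR_gt0.
have -> : vol z (lambda * rho) `^ (- s^-1) = V'^-1 by rewrite powRN.
rewrite ler_pdivrMr// mulrA mulrAC ler_pdivlMr//.
rewrite -(@ler_pM2l _ rho) in h'; last by [].
apply: (le_trans h'); rewrite le_eqVlt; apply/orP; left; apply/eqP.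
by field; rewrite gt_eqF.
Qed.

Lemma osc_le_scale (z : P) (rho a : R) : 0 < rho <= 2 * r -> Bhat z ->
  ball z (lambda * rho) `<=` Bhat -> vol z (lambda * rho) <= a ->
  (osc u z rho <= (4 * cPI * cs `^ (- s^-1) *
     (r / vol x (2 * lambda * r) `^ s^-1))%:E * RN a)%E.
Proof.
move=> rho2 zB sub va; have /andP[rho0 _] := rho2.
apply: le_trans (osc_le_rearrangement rho0 sub va) _.
rewrite lee_wpmul2r ?rearrangement_norm_ge0// lee_fin.
have := radius_volume_scale rho2 zB; rewrite -(@ler_pM2l _ (2 * cPI)) ?mulr_gt0// => h.
have -> : cPI * (2 * rho) * vol z (lambda * rho) `^ (- s^-1) =
  2 * cPI * (rho * vol z (lambda * rho) `^ (- s^-1)) by ring.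
apply: le_trans h _; rewrite le_eqVlt; apply/orP; left; apply/eqP; ring.
Qed.

Context (alpha Z S : R) (N : nat).
Hypothesis alpha0 : 0 <= alpha.
Hypothesis Z0 : 0 <= Z.
Hypothesis S0 : 0 < S.
Hypothesis HZ : (zygmund_norm mu s alpha Bhat (G \_ Bhat) <= Z%:E)%E.
Hypothesis HS : forall (E : set P) (f : P -> \bar R) (q : nat),
  0 < fine (mu E) ->
  (\sum_(i < q) rearrangement_norm mu s f (fine (mu E) * 2 ^- i)%R <=
   S%:E * zygmund_norm mu s alpha E f)%E.
(** By [dimension_vol], dilation by [lambda] then undoes at most [N] halvings of the volume. *)
Hypothesis HN : lambda `^ s / cs <= 2 ^+ N.

Let m : R := vol x (2 * lambda * r).
Let rn a : R := fine (RN a).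
Let D : R := 2 `^ s / cs.
Let K : R := 4 * cPI * cs `^ (- s^-1) * (r / m `^ s^-1).
Local Notation av z rho := (fine (average mu (ball z rho) u)).

Let m0 : 0 < m. Proof. exact: (vol_gt0 Hmu). Qed.

Let K0 : 0 <= K.
Proof. by rewrite !mulr_ge0 ?invr_ge0 ?powR_ge0// ltW. Qed.

Let cs1 : cs <= 1.
Proof.
have := Hdim (x := x) (y := x) (r := r) (r' := r); rewrite r0 lexx => /(_ isT).
by rewrite !divff ?gt_eqF ?(vol_gt0 Hmu)// powR1 mulr1; apply; exact: ballxx.
Qed.

Let D1 : 1 <= D.
Proof.
rewrite /D ler_pdivlMr// mul1r; apply: (le_trans cs1).
apply: (@le_trans _ _ (1 `^ s)); first by rewrite powR1.
by apply: ge0_ler_powR; rewrite ?nnegrE ?ler1n// ltW.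
Qed.

Let D0 : 0 < D. Proof. exact: lt_le_trans D1. Qed.

Lemma rearrangement_norm_fine (a : R) : 0 < a <= m ->
  [/\ RN a = (rn a)%:E, 0 <= rn a & rn a <= Z].
Proof.
move=> am.
have le : (RN a <= Z%:E)%E.
  exact: le_trans (rearrangement_norm_le_zygmund (G \_ Bhat) s0 alpha0 am) HZ.
have fin : RN a \is a fin_num.
  by rewrite ge0_fin_numE ?rearrangement_norm_ge0// (le_lt_trans le)// ltry.
split; first by rewrite /rn fineK.
  by rewrite /rn fine_ge0// rearrangement_norm_ge0.
by rewrite -lee_fin /rn fineK.
Qed.

Lemma halves_itv (i : nat) : 0 < m * 2 ^- i <= m.
Proof.
rewrite mulr_gt0 ?invr_gt0 ?exprn_gt0//= ger_pMr// invf_le1 ?exprn_gt0//.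
by rewrite exprn_ege1// ler1n.
Qed.

Lemma sum_rearrangement_norm_fine (q : nat) :
  \sum_(i < q) rn (m * 2 ^- i) <= S * Z.
Proof.
rewrite -lee_fin -sumEFin.
have := HS (G \_ Bhat) q m0; rewrite -/m => h.
apply: (@le_trans _ _ (\sum_(i < q) RN (m * 2 ^- i))%E).
  by apply: lee_sum => i _; have [->] := rearrangement_norm_fine (halves_itv i).
by apply: (le_trans h); rewrite EFinM lee_wpmul2l// lee_fin ltW.
Qed.

Lemma sub_Bhat (z : P) (rho : R) : ball x r z -> rho <= r ->
  ball z (lambda * rho) `<=` Bhat.
Proof.
move=> xz rhor; apply: subset_metric_ball; move: xz; rewrite ballEmdist/= => xz.
have h1 : lambda * rho <= lambda * r by rewrite ler_wpM2l// ltW.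
have h2 : r <= lambda * r by rewrite ler_peMl// ltW.
have -> : 2 * lambda * r = lambda * r + lambda * r by ring.
by apply: lerD => //; apply: le_trans h2; exact: ltW.
Qed.

Lemma in_Bhat (z : P) : ball x r z -> Bhat z.
Proof.
apply: le_ball; have : r <= lambda * r by rewrite ler_peMl// ltW.
move=> h; rewrite -mulrA mulr_natl mulr2n; apply: (le_trans h).
by rewrite lerDl mulr_ge0// ltW.
Qed.

Lemma osc_ge0 (z : P) (rho : R) : (0 <= osc u z rho)%E.
Proof. by apply: average_ge0 => y _; exact: abse_ge0. Qed.

Lemma osc_le_K (z : P) (rho a : R) : ball x r z -> 0 < rho <= r ->
  vol z (lambda * rho) <= a -> a <= m -> (osc u z rho <= (K * rn a)%:E)%E.
Proof.
move=> xz /andP[rho0 rhor] va am.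
have a0 : 0 < a by apply: lt_le_trans va; apply: (vol_gt0 Hmu); rewrite mulr_gt0.
have [|E _ _] := @rearrangement_norm_fine a; first by rewrite a0.
rewrite EFinM -E; apply: osc_le_scale => //; last 2 first.
- exact: in_Bhat.
- exact: sub_Bhat.
by rewrite rho0 (le_trans rhor)// ler_peMl ?ler1n// ltW.
Qed.

Lemma osc_fin (z : P) (rho : R) : ball x r z -> 0 < rho <= r ->
  osc u z rho \is a fin_num.
Proof.
move=> xz rhor; have /andP[rho0 rhor'] := rhor.
have := @osc_le_K z rho m xz rhor.
rewrite lexx (le_vol Hmu) ?mulr_gt0//; last exact: sub_Bhat.
move=> /(_ isT isT) h; rewrite ge0_fin_numE ?osc_ge0//.
by apply: le_lt_trans h _; rewrite ltry.
Qed.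

(** [chain_bound] applies along the radii [r * 2 ^- i]. The sequence [psi] is shifted by [N], since
    the volumes that matter are those of the dilated balls. *)
Lemma average_chain (z : P) (n : nat) : ball x r z ->
  `|av z (r * 2 ^- n) - av z r| <= 2 * D * (K * ((N%:R + S) * Z)).
Proof.
move=> xz.
have rho0 i : 0 < r * 2 ^- i by rewrite mulr_gt0 ?invr_gt0 ?exprn_gt0.
have rhor i : 0 < r * 2 ^- i <= r.
  rewrite rho0/= ger_pMr// invf_le1 ?exprn_gt0//.
  by rewrite exprn_ege1// ler1n.
have rho_le i j : (i <= j)%N -> r * 2 ^- j <= r * 2 ^- i.
  move=> ij; rewrite ler_pM2l// lef_pV2 ?posrE ?exprn_gt0//.
  by rewrite ler_weXn2l// ler1n.
have volm q : vol z r * 2 ^- q <= m * 2 ^- q.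
  rewrite ler_wpM2r ?invr_ge0 ?exprn_ge0// (le_vol Hmu)//.
  apply: subset_trans (sub_Bhat xz (lexx r)).
  by apply: le_ball; rewrite ler_peMl// ltW.
have := @chain_bound _ (fun i => av z (r * 2 ^- i)) (fun i => fine (osc u z (r * 2 ^- i)))
  (fun i => vol z (r * 2 ^- i)) (fun q => K * rn (m * 2 ^- (q - N))) D
  (K * ((N%:R + S) * Z)) D1.
rewrite expr0 invr1 mulr1; apply.
- by move=> i; exact: (vol_gt0 Hmu).
- by move=> i j ij; apply: (le_vol Hmu) => //; apply: le_ball; exact: rho_le.
- move=> i; have rE : 2 * (r * 2 ^- i.+1) = r * 2 ^- i.
    by rewrite exprS invfM mulrCA (mulrA 2) divff// mul1r.
  rewrite -rE; apply: (dimension_vol Hmu cs0 (ltW s0) Hdim) => //.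
    by rewrite ler1n.
  by apply: ballxx; rewrite mulr_gt0.
- move=> i j ij; rewrite -lee_fin EFinM fineK ?osc_fin//.
  apply: average_ball_dist => //; last exact: iu.
  by apply: le_ball; exact: rho_le.
- move=> i q Vq; rewrite -lee_fin fineK ?osc_fin//; apply: osc_le_K => //; last first.
    by have /andP[] := halves_itv (q - N).
  (* For [q <= N] the shifted index is 0, and the dilated ball is simply compared with [Bhat]. *)
  have [qN|Nq] := leqP q N.
    move: qN; rewrite -subn_eq0 => /eqP ->; rewrite expr0 invr1 mulr1.
    apply: (le_vol Hmu) => //; first by rewrite mulr_gt0.
    by apply: sub_Bhat => //; have /andP[] := rhor i.
  apply: (le_trans (dimension_vol Hmu cs0 (ltW s0) Hdim (rho0 i) lambda1 _)).
    by apply: ballxx; rewrite mulr_gt0.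
  apply: le_trans (volm (q - N)%N).
  apply: (@le_trans _ _ (2 ^+ N * (vol z r * 2 ^- q))).
    by apply: ler_pM => //; rewrite divr_ge0 ?powR_ge0// ltW.
  rewrite mulrCA ler_wpM2l ?fine_ge0// -[in leLHS](subnK (ltnW Nq)) exprD invfM.
  by rewrite mulrCA mulfV ?mulr1// gt_eqF// exprn_gt0.
- by move=> q; rewrite mulr_ge0//; have [] := rearrangement_norm_fine (halves_itv (q - N)).
move=> q; rewrite -mulr_sumr ler_wpM2l// mulrDl.
have := @sum_shift_le _ (fun i => rn (m * 2 ^- i)) N q.
have rn0 i : 0 <= rn (m * 2 ^- i) by have [] := rearrangement_norm_fine (halves_itv i).
move=> /(_ rn0) h; apply: (le_trans h); apply: lerD.
  rewrite ler_wpM2l//; first by have [] := rearrangement_norm_fine (halves_itv 0).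
exact: sum_rearrangement_norm_fine.
Qed.

(** The ball about [z] need not lie in [ball x r] but lies in the ball of twice the radius, whose
    dilation is [Bhat]: this is the origin of the factor 2 in [2 * lambda * r]. *)
Lemma average_center (z : P) : ball x r z -> `|av z r - av x (2 * r)| <= D * (K * Z).
Proof.
move=> xz; have rr0 : 0 < 2 * r by rewrite mulr_gt0.
have oscK : (osc u x (2 * r) <= (K * Z)%:E)%E.
  have [|E _ rnZ] := @rearrangement_norm_fine m; first by rewrite m0 lexx.
  apply: (@le_trans _ _ (K * rn m)%:E); last by rewrite lee_fin ler_wpM2l.
  rewrite EFinM -E; have eqB : lambda * (2 * r) = 2 * lambda * r by rewrite mulrCA mulrA.
  apply: osc_le_scale => //; rewrite ?eqB ?lexx ?rr0//.
  by apply: ballxx.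
have sub : ball z r `<=` ball x (2 * r).
  apply: subset_metric_ball; rewrite mulr_natl mulr2n lerD2r.
  by move: xz; rewrite ballEmdist/= => /ltW.
have ratio : vol x (2 * r) / vol z r <= D.
  rewrite ler_pdivrMr ?(vol_gt0 Hmu)//.
  apply: (dimension_vol Hmu cs0 (ltW s0) Hdim) => //; first by rewrite ler1n.
  by apply: le_ball xz; rewrite ler_peMl ?ler1n// ltW.
have h := average_ball_dist rr0 r0 sub (iu x rr0).
rewrite -lee_fin; apply: (le_trans h); rewrite [leRHS]EFinM; apply: lee_pmul => //.
by apply: average_ge0 => y _; exact: abse_ge0.
Qed.

Let M : R := 2 * D * (N%:R + S + 1) * K * Z.

(** [M] adds the chain at [z] to two uses of [average_center], at [z] and at [x] itself. *)
Lemma average_close (z : P) (n : nat) : ball x r z ->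
  `|av z (r * 2 ^- n) - av x r| <= M.
Proof.
move=> xz; have h1 := average_chain n xz; have h2 := average_center xz.
have h3 := average_center (ballxx x r0); rewrite distrC in h3.
have -> : av z (r * 2 ^- n) - av x r = (av z (r * 2 ^- n) - av z r) +
   (av z r - av x (2 * r)) + (av x (2 * r) - av x r) by ring.
have -> : M = 2 * D * (K * ((N%:R + S) * Z)) + D * (K * Z) + D * (K * Z).
  by rewrite /M; ring.
apply: (le_trans (ler_normD _ _)); apply: lerD h3.
by apply: (le_trans (ler_normD _ _)); apply: lerD h1 h2.
Qed.

(* Either the dilated ball has small measure, and the rearrangement norm over it
   is small, or its measure is bounded below, and the radius is small. *)
Lemma osc_uniformly_small (delta : R) : 0 < delta ->
  exists n : nat, forall z, ball x r z -> (osc u z (r * 2 ^- n) <= delta%:E)%E.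
Proof.
move=> delta0.
(* The norms decrease along the halves, so [q * rn a] is at most the sum [S * Z]; this [q] makes
   [K * rn a] at most [delta]. *)
pose q := (Num.truncn (K * (S * Z) / delta)).+1.
pose a := m * 2 ^- q.
have [a0 am] : 0 < a /\ a <= m by apply/andP; exact: halves_itv.
have [aE rna0 rnaZ] := @rearrangement_norm_fine a (halves_itv q).
have rna : K * rn a <= delta.
  have sum_ge : q%:R * rn a <= S * Z.
    apply: le_trans (sum_rearrangement_norm_fine q).
    rewrite mulr_natl -[q in leLHS]card_ord -sumr_const; apply: ler_sum => i _.
    have [E _ _] := rearrangement_norm_fine (halves_itv i).
    rewrite -lee_fin -aE -E; apply: le_rearrangement_norm => //.
    rewrite ler_pM2l// lef_pV2 ?posrE ?exprn_gt0//.
    by rewrite ler_weXn2l ?ler1n// ltnW.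
  have q0 : 0 < q%:R :> R by rewrite ltr0n.
  rewrite -(@ler_pM2l _ q%:R)// mulrCA.
  apply: (@le_trans _ _ (K * (S * Z))); first by rewrite ler_wpM2l.
  by rewrite -ler_pdivrMr// ltW// truncnS_gt.
have [mE rnm0 rnmZ] : [/\ RN m = (rn m)%:E, 0 <= rn m & rn m <= Z].
  by apply: rearrangement_norm_fine; rewrite m0 lexx.
(* If the dilated ball has volume above [a], the oscillation at radius [r * 2 ^- n] is at most
   [X * 2 ^- n]. *)
pose X := cPI * (2 * r) * a `^ (- s^-1) * Z.
pose n := (Num.truncn (X / delta)).+1.
have X0 : 0 <= X by rewrite !mulr_ge0 ?powR_ge0// ltW.
have Xn : X * 2 ^- n <= delta.
  rewrite ler_pdivrMr ?exprn_gt0// mulrC -ler_pdivrMr//.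
  apply: (@le_trans _ _ n%:R); first by rewrite ltW// truncnS_gt.
  by rewrite -natrX ler_nat ltnW// ltn_expl.
have rho0 : 0 < r * 2 ^- n by rewrite mulr_gt0 ?invr_gt0 ?exprn_gt0.
have rhor : r * 2 ^- n <= r.
  by rewrite ger_pMr// invf_le1 ?exprn_gt0// exprn_ege1// ler1n.
exists n => z xz; have lrho0 : 0 < lambda * (r * 2 ^- n) by rewrite mulr_gt0.
have [va|av] := leP (vol z (lambda * (r * 2 ^- n))) a.
  have rhoI : 0 < r * 2 ^- n <= r by rewrite rho0.
  by apply: le_trans (osc_le_K xz rhoI va am) _; rewrite lee_fin.
have vm : vol z (lambda * (r * 2 ^- n)) <= m.
  by apply: (le_vol Hmu) => //; exact: sub_Bhat.
apply: (le_trans (osc_le_rearrangement rho0 (sub_Bhat xz rhor) vm)).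
rewrite mE -EFinM lee_fin; apply: le_trans Xn.
have -> : X * 2 ^- n = cPI * (2 * (r * 2 ^- n)) * a `^ (- s^-1) * Z.
  by rewrite /X; ring.
apply: ler_pM => //; first by rewrite !mulr_ge0 ?powR_ge0// ltW.
rewrite ler_wpM2l//; first by rewrite !mulr_ge0// ltW.
rewrite !powRN lef_pV2 ?posrE ?powR_gt0 ?(vol_gt0 Hmu)//.
by apply: ge0_ler_powR; rewrite ?nnegrE ?invr_ge0 ?(ltW s0) ?(ltW a0)// ?fine_ge0// ltW.
Qed.

(* Markov's inequality on a net of balls of vanishing oscillation stands in for
   the Lebesgue differentiation theorem. *)
Lemma null_superlevel (a : R) : M < a ->
  mu [set y | ball x r y /\ (a%:E < `|u y - (av x r)%:E|)%E] = 0%E.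
Proof.
move=> Ma; set E := [set y | _].
have mB z rho := measurable_metric_ball Hmu z rho.
have mE : measurable E.
  have -> : E = ball x r `&` [set y | (a%:E < `|u y - (av x r)%:E|)%E] by [].
  apply: emeasurable_fun_o_infty => //.
  apply: measurableT_comp => //; apply: emeasurable_funB => //.
  exact: measurable_int (iu x r0).
have aM0 : 0 < a - M by rewrite subr_gt0.
pose v2 := vol x (2 * r).
have v20 : 0 < v2 by apply: (vol_gt0 Hmu); rewrite mulr_gt0.
apply/eqP; rewrite eq_le measure_ge0 andbT; apply/lee_addgt0Pr => e e0; rewrite add0e.
(* Chosen so that the Markov bounds add up over the net to [delta / (a - M) * D * v2 = e]. *)
pose delta := e * (a - M) / (D * v2).
have delta0 : 0 < delta by apply: divr_gt0; apply: mulr_gt0.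
have [n oscn] := osc_uniformly_small delta0.
set rho := r * 2 ^- n in oscn.
have rho0 : 0 < rho by rewrite mulr_gt0 ?invr_gt0 ?exprn_gt0.
have rhor : rho <= r.
  by rewrite ger_pMr// invf_le1 ?exprn_gt0// exprn_ege1// ler1n.
have rho20 : 0 < rho / 2 by rewrite divr_gt0.
have half z : vol z rho <= D * vol z (rho / 2).
  have -> : rho = 2 * (rho / 2) by rewrite mulrCA divff// mulr1.
  rewrite [in leRHS](_ : 2 * (rho / 2) / 2 = rho / 2); last by rewrite mulrAC divff// mul1r.
  apply: (dimension_vol Hmu cs0 (ltW s0) Hdim) => //; first by rewrite ler1n.
  by apply: ballxx; rewrite mulr_gt0.
(* On [E], [u] is more than [a] away from its average over [ball x r], which is within [M] of the
   average over [ball z rho]; Markov's inequality applies at height [a - M]. *)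
have markov z : ball x r z ->
    (mu (E `&` ball z rho) <= (delta / (a - M) * vol z rho)%:E)%E.
  move=> xz.
  have fz : average mu (ball z rho) u \is a fin_num.
    by apply: average_fin => //; exact: iu.
  have oscE : (\int[mu]_(y in ball z rho) `|u y - (av z rho)%:E| =
      (vol z rho)%:E * osc u z rho)%E.
    rewrite [in RHS]/average (fineK fz) muleA -EFinM divff ?mul1e// gt_eqF//.
    exact: (vol_gt0 Hmu).
  have mg : measurable_fun (ball z rho) (fun y => (u y - (av z rho)%:E)%E).
    by apply: emeasurable_funB => //; exact: measurable_int (iu z rho0).
  have := @le_integral_comp_abse _ _ _ mu (ball z rho) (mB z rho) _ (a - M) id
    (@measurable_id _ _ setT) (fun r r0 => r0) (fun _ _ _ _ h => h) mg aM0.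
  rewrite /= oscE => h.
  have sub : E `&` ball z rho `<=` ball z rho `&`
      [set y | ((a - M)%:E <= `|u y - (av z rho)%:E|)%E].
    move=> y [[xy Ey] zy]; split => //=.
    have hav := average_close n xz; rewrite -/rho in hav.
    move: Ey; case: (u y) => [w||] /=; rewrite ?leey// lte_fin lee_fin => aw.
    rewrite lerBlDr; apply: le_trans (ltW aw) _.
    have -> : w - av x r = (w - av z rho) + (av z rho - av x r) by ring.
    by apply: (le_trans (ler_normD _ _)); rewrite lerD2l.
  have le1 : (mu (E `&` ball z rho) <= mu (ball z rho `&`
      [set y | ((a - M)%:E <= `|u y - (av z rho)%:E|)%E]))%E.
    apply: le_measure; rewrite ?inE//; first exact: measurableI.
    by apply: emeasurable_fun_c_infty => //; exact: measurableT_comp.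
  have : ((a - M)%:E * mu (E `&` ball z rho) <= (vol z rho * delta)%:E)%E.
    apply: (@le_trans _ _ ((a - M)%:E * mu (ball z rho `&`
      [set y | ((a - M)%:E <= `|u y - (av z rho)%:E|)%E]))%E).
      by rewrite lee_wpmul2l// lee_fin ltW.
    apply: (le_trans h); rewrite EFinM lee_wpmul2l ?lee_fin ?fine_ge0//.
    exact: oscn.
  move=> h2; rewrite -(@lee_pmul2l _ (a - M)%:E)//.
  apply: (le_trans h2); rewrite -EFinM lee_fin [leRHS]mulrA [X in _ <= X * _](mulrC (a - M)).
  by rewrite divfK ?gt_eqF// mulrC.
have [l [lB lcov lsum]] : exists l : seq P, [/\ forall z, z \in l -> ball x r z,
    forall y, ball x r y -> exists2 z, z \in l & ball z rho y &
    \sum_(z <- l) vol z (rho / 2) <= vol x (2 * r)].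
  (* The dimension condition between the radii [rho / 2] and [r] gives the lower bound on volumes
     that [exists_net] asks for. *)
  pose k := r / (rho / 2).
  have k1 : 1 <= k.
    rewrite /k ler_pdivlMr// mul1r (le_trans _ rhor)// ler_pdivrMr// ler_peMr ?ler1n//.
    exact: ltW.
  have kE : k * (rho / 2) = r by rewrite /k divfK// gt_eqF.
  have k0 : 0 < k by exact: lt_le_trans k1.
  apply: (exists_net Hmu (c := (k `^ s / cs)^-1 * vol x r)) => //.
    by rewrite mulr_gt0 ?(vol_gt0 Hmu)// invr_gt0 divr_gt0 ?powR_gt0.
  move=> z xz; rewrite ler_pdivrMl ?divr_gt0 ?powR_gt0//.
  by rewrite -{1}kE; apply: (dimension_vol Hmu cs0 (ltW s0) Hdim); rewrite ?kE.
have bound (t : seq P) : (forall z, z \in t -> ball x r z) ->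
    (mu (\big[setU/set0]_(z <- t) (E `&` ball z rho)) <=
     (delta / (a - M) * D * \sum_(z <- t) vol z (rho / 2))%:E)%E.
  elim: t => [|z t IH] tB; first by rewrite !big_nil measure0 mulr0.
  rewrite !big_cons; apply: le_trans (measureU2 _ _ _) _ => //.
  - exact: measurableI.
  - by apply: bigsetU_measurable => w _; exact: measurableI.
  rewrite mulrDr EFinD; apply: leeD; last first.
    by apply: IH => w wt; apply: tB; rewrite inE wt orbT.
  apply: (le_trans (markov z _)); first by apply: tB; rewrite inE eqxx.
  rewrite lee_fin -[leRHS]mulrA; apply: ler_wpM2l => //.
  exact: divr_ge0 (ltW delta0) (ltW aM0).
apply: (@le_trans _ _ (mu (\big[setU/set0]_(z <- l) (E `&` ball z rho)))).
  apply: le_measure; rewrite ?inE//.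
    by apply: bigsetU_measurable => w _; exact: measurableI.
  move=> y Ey; rewrite -bigcup_seq; have [z zl zy] := lcov y Ey.1.
  by exists z => //=; split.
apply: le_trans (bound l lB) _; rewrite lee_fin.
apply: (@le_trans _ _ (delta / (a - M) * D * v2)).
  rewrite ler_wpM2l// mulr_ge0 ?(ltW D0)// divr_ge0 ?(ltW delta0)//.
  exact: ltW.
rewrite /delta le_eqVlt; apply/orP; left; apply/eqP.
by field; rewrite ?gt_eqF.
Qed.

End FixedBall.
End Oscillation.

(** * The embedding constants and the theorem *)

Section Embedding.
Context {d : measure_display} {R : realType} {P : metricMeasurableType d R}.
Context (mu : {measure set P -> \bar R}) (nrm : (P -> \bar R) -> \bar R).
Context (s alpha lambda cs ctri : R) (cemb : P -> R -> R).
Hypothesis Hmu : borel_regular_measure mu.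
Hypothesis Hnrm : quasi_banach_lattice_with mu nrm ctri.
Hypothesis s1 : 1 <= s.
Hypothesis lambda1 : 1 <= lambda.
Hypothesis alpha0 : 0 <= alpha.
Hypothesis cs0 : 0 < cs.
Hypothesis Hdim : forall (x y : P) (r r' : R),
  0 < r <= r' -> ball x r' y ->
  cs * (r / r') `^ s <= fine (mu (ball y r)) / fine (mu (ball x r')).
Hypothesis Hemb : forall (x : P) (r : R), 0 < r ->
  smallest_embedding_constant mu nrm s alpha (ball x r) (cemb x r).

Let s0 : 0 < s. Proof. exact: lt_le_trans s1. Qed.
Let lambda0 : 0 < lambda. Proof. exact: lt_le_trans lambda1. Qed.

Lemma measurable_restrict_ball (u : P -> \bar R) (x : P) (r : R) :
  measurable_fun setT u -> measurable_fun setT (u \_ (ball x r)).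
Proof.
move=> mu_; apply/(measurable_restrictT _ _).1.
  exact: (measurable_metric_ball Hmu).
exact: measurable_funTS.
Qed.

Lemma norm_restrict_le (u : P -> \bar R) (x : P) (r : R) :
  measurable_fun setT u -> (nrm (u \_ (ball x r)) <= nrm u)%E.
Proof.
move=> mu_; apply: (qbl_mono Hnrm) => //; first exact: measurable_restrict_ball.
apply: aeW => y; rewrite patchE; case: ifPn => // _.
by rewrite abse0 abse_ge0.
Qed.

(** The embedding makes |u|^s integrable on the ball, where |u| <= 1 + |u|^s and the measure is
    finite. *)
Lemma in_lattice_integrable_ball (u : P -> \bar R) (x : P) (r : R) : 0 < r ->
  in_lattice nrm u -> mu.-integrable (ball x r) u.
Proof.
move=> r0 [mu_ ufin]; have mB := measurable_metric_ball Hmu x r.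
have [[c0 emb] _] := Hemb x r0.
have vE := volE Hmu x r0.
have zfin : (zygmund_norm mu s alpha (ball x r) (u \_ (ball x r)) < +oo)%E.
  apply: le_lt_trans (emb _ mu_) _; apply: lte_mul_pinfty => //.
    by rewrite lee_fin ltW.
  exact: le_lt_trans (norm_restrict_le x r mu_) ufin.
have powfin : (\int[mu]_(y in ball x r) (`|u y| `^ s) < +oo)%E.
  rewrite (@eq_integral _ _ _ _ _ (fun y => `|(u \_ (ball x r)) y| `^ s)%E); last first.
    by move=> y yB; rewrite patchE yB.
  apply: le_lt_trans (hardy_littlewood s0 _ mB _) _.
  - exact: measurable_restrict_ball.
  - by rewrite vE.
  have := rearrangement_norm_le_zygmund (mu := mu) (E := ball x r) (a := fine (mu (ball x r)))
    (u \_ (ball x r)) s0 alpha0.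
  rewrite lexx (vol_gt0 Hmu)// => /(_ isT) h.
  apply: (@lty_poweRy _ _ s^-1); first by rewrite invr_neq0// gt_eqF.
  exact: le_lt_trans h zfin.
have mpow : measurable_fun (ball x r) (fun y => `|u y| `^ s)%E.
  apply: (measurableT_comp (measurable_poweR _)).
  by apply: measurableT_comp => //; exact: measurable_funTS.
apply/integrableP; split; first exact: measurable_funTS.
apply: (@le_lt_trans _ _ (\int[mu]_(y in ball x r) (1 + `|u y| `^ s))%E).
  apply: ge0_le_integral => //.
  - by apply: measurableT_comp => //; exact: measurable_funTS.
  - exact: emeasurable_funD.
  move=> y _; have := abse_ge0 (u y); case: (`|u y|%E) => [t||]//; last first.
    by move=> _; rewrite poweRyr ?gt_eqF// addey.
  rewrite lee_fin => t0; rewrite poweR_EFin -EFinD lee_fin.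
  have [t1|t1] := leP t 1; first by rewrite (le_trans t1)// lerDl powR_ge0.
  have : t `^ 1 <= t `^ s by rewrite ler_powR// ltW.
  by rewrite powRr1// => /le_trans; apply; rewrite lerDr.
rewrite ge0_integralD//; last by move=> y _; exact: poweR_ge0.
by rewrite integral_cst// mul1e vE lte_add_pinfty// ltry.
Qed.

(** The embedding on the larger ball is tested with functions cut off to the smaller one; as the
    Zygmund norm grows with the ball, [cemb x' r'] is admissible there. *)
Lemma embedding_constant_mono (x x' : P) (r r' : R) : 0 < r -> 0 < r' ->
  ball x r `<=` ball x' r' -> cemb x r <= cemb x' r'.
Proof.
move=> r0 r'0 sub; have [_ small] := Hemb x r0; apply: small.
have [[c0 emb] _] := Hemb x' r'0; split => // u mu_.
have restr : (u \_ (ball x r)) \_ (ball x' r') = u \_ (ball x r).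
  apply/funext => y; rewrite !patchE; case: ifPn => // /negP yB'.
  by case: ifPn => //; rewrite inE => /sub yB; exfalso; apply: yB'; rewrite inE.
have := emb _ (measurable_restrict_ball x r mu_); rewrite restr; apply: le_trans.
apply: le_zygmund_norm => //; exact: (le_vol Hmu).
Qed.

(** The computation of [radius_volume_scale] with [k = R0 / r], combined with the monotonicity of
    [cemb]. *)
Lemma embedding_scale_mono (x x0 : P) (r R0 : R) : 0 < r <= R0 ->
  ball x (2 * lambda * r) `<=` ball x0 (2 * lambda * R0) ->
  embedding_scale mu cemb s lambda x r <=
  cs `^ (- s^-1) * embedding_scale mu cemb s lambda x0 R0.
Proof.
move=> /andP[r0 rR] sub; have R00 : 0 < R0 by exact: lt_le_trans rR.
have lr0 : 0 < 2 * lambda * r by rewrite !mulr_gt0.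
have lR0 : 0 < 2 * lambda * R0 by rewrite !mulr_gt0.
have inv0 : 0 <= s^-1 by rewrite invr_ge0 ltW.
have V0 := vol_gt0 Hmu x lr0; have m0 := vol_gt0 Hmu x0 lR0.
have cemb_le := embedding_constant_mono lr0 lR0 sub.
have [[c0 _] _] := Hemb x lr0.
have k1 : 1 <= R0 / r by rewrite ler_pdivlMr// mul1r.
have kE : R0 / r * (2 * lambda * r) = 2 * lambda * R0.
  by field; rewrite gt_eqF.
have xin : ball x0 (R0 / r * (2 * lambda * r)) x.
  by rewrite kE; apply: sub; exact: ballxx.
have := dimension_vol Hmu cs0 (ltW s0) Hdim lr0 k1 xin; rewrite kE.
rewrite /embedding_scale; set V := fine (mu (ball x _)); set m := fine (mu _) => h.
have k0 : 0 <= R0 / r by exact: le_trans k1.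
have mV : m `^ s^-1 <= R0 / r * cs `^ (- s^-1) * V `^ s^-1.
  apply: le_trans (ge0_ler_powR inv0 _ _ h) _.
  - by rewrite nnegrE ltW.
  - by rewrite nnegrE mulr_ge0 ?(ltW V0)// divr_ge0 ?powR_ge0// ltW.
  rewrite powRM ?(ltW V0)//; last by rewrite divr_ge0 ?powR_ge0// ltW.
  rewrite powRM ?powR_ge0 ?invr_ge0 ?(ltW cs0)// -powRrM divff ?gt_eqF// powRr1//.
  by rewrite powR_inv// ltW.
have m'0 : 0 < m `^ s^-1 by rewrite powR_gt0.
have V'0 : 0 < V `^ s^-1 by rewrite powR_gt0.
have ratio : r / V `^ s^-1 <= cs `^ (- s^-1) * R0 / m `^ s^-1.
  rewrite ler_pdivrMr// mulrAC ler_pdivlMr//.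
  rewrite -(@ler_pM2l _ r) in mV; last by [].
  apply: (le_trans mV); rewrite le_eqVlt; apply/orP; left; apply/eqP.
  by field; rewrite gt_eqF.
have -> : cs `^ (- s^-1) * (cemb x0 (2 * lambda * R0) * R0 / m `^ s^-1) =
  cemb x0 (2 * lambda * R0) * (cs `^ (- s^-1) * R0 / m `^ s^-1) by ring.
rewrite -mulrA; apply: ler_pM => //; first exact: ltW.
by rewrite divr_ge0 ?powR_ge0// ltW.
Qed.

Lemma embedding_scale_gt0 (x : P) (r : R) : 0 < r ->
  0 < embedding_scale mu cemb s lambda x r.
Proof.
move=> r0; have lr0 : 0 < 2 * lambda * r by rewrite !mulr_gt0.
have [[c0 _] _] := Hemb x lr0.
by rewrite /embedding_scale divr_gt0 ?mulr_gt0// powR_gt0// (vol_gt0 Hmu).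
Qed.

(** The quasi-triangle inequality is applied once, after the embedding, so [ctri] appears as a mere
    factor. *)
Lemma zygmund_norm_approx (x : P) (r e : R) (g g' rho : P -> \bar R) : 0 < r -> 0 < e ->
  measurable_fun setT g -> (nrm g < +oo)%E ->
  measurable_fun setT g' -> {ae mu, forall y, g' y = g y} ->
  in_lattice nrm rho ->
  (zygmund_norm mu s alpha (ball x r) ((fun y => g' y + e%:E * rho y) \_ (ball x r)) <=
   (cemb x r * (ctri * (fine (nrm (g \_ (ball x r))) + e * fine (nrm rho))))%:E)%E.
Proof.
move=> r0 e0 mg gfin mg' g'g [mrho rhofin].
have [[c0 emb] _] := Hemb x r0.
have merho : measurable_fun setT (fun y => e%:E * rho y)%E by exact: emeasurable_funM.
apply: le_trans (emb _ _) _; first exact: emeasurable_funD.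
rewrite EFinM lee_wpmul2l ?lee_fin ?(ltW c0)//.
have -> : (fun y => g' y + e%:E * rho y)%E \_ (ball x r) =
    (fun y => (g' \_ (ball x r)) y + ((fun y => e%:E * rho y) \_ (ball x r)) y)%E.
  by apply/funext => y; rewrite !patchE; case: ifPn => // _; rewrite adde0.
apply: le_trans (qbl_triangle Hnrm _ _) _; [exact: measurable_restrict_ball..|].
have gB_fin : nrm (g \_ (ball x r)) \is a fin_num.
  rewrite ge0_fin_numE; last exact/(qbl_ge0 Hnrm)/measurable_restrict_ball.
  exact: le_lt_trans (norm_restrict_le x r mg) gfin.
have rho_fin : nrm rho \is a fin_num.
  by rewrite ge0_fin_numE//; exact: (qbl_ge0 Hnrm).
rewrite EFinM lee_wpmul2l//.
  by rewrite lee_fin (le_trans ler01)// (qbl_ctri Hnrm).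
rewrite EFinD EFinM !fineK//; apply: leeD.
  apply: (qbl_mono Hnrm); [exact: measurable_restrict_ball..|].
  apply: filterS g'g => y; rewrite !patchE => ->.
  by case: ifPn.
apply: le_trans (norm_restrict_le x r merho) _.
by rewrite (qbl_scale Hnrm)// gtr0_norm.
Qed.

End Embedding.

Theorem proposition6p5 (d : measure_display) (R : realType)
    (P : metricMeasurableType d R) (mu : {measure set P -> \bar R})
    (nrm : (P -> \bar R) -> \bar R)
    (s lambda alpha : R) (cemb : P -> R -> R) :
  borel_regular_measure mu ->
  doubling mu ->
  quasi_banach_lattice mu nrm ->
  1 <= s -> 1 <= lambda ->
  poincare mu s lambda ->
  dimension_condition mu s ->
  (s = 1 -> 1 <= alpha) -> (1 < s -> 1 < alpha) ->
  (forall (x : P) (r : R), 0 < r ->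
    smallest_embedding_constant mu nrm s alpha (ball x r) (cemb x r)) ->
  let K := embedding_scale mu cemb s lambda in
  exists2 C : R, 0 < C & forall (x0 : P) (R0 : R), 0 < R0 ->
    (exists2 c : R, 0 < c & forall (x : P) (r : R), 0 < r < R0 ->
       ball x r `<=` ball x0 R0 ->
       forall u g : P -> \bar R,
       newtonian nrm u -> in_lattice nrm g -> weak_upper_gradient nrm u g ->
       let N := nrm (g \_ (ball x (2 * lambda * r))) in
       (capacity_ess_sup nrm (ball x r)
            (fun y => `|u y - average mu (ball x r) u|) <= (C * K x r)%:E * N /\
        (K x r)%:E * N <= c%:E * N)%E) /\
    (exists2 c : R, 0 < c & C^-1 * K x0 R0 <= c <= C * K x0 R0 /\
       forall (x : P) (r : R), 0 < r < R0 ->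
       ball x r `<=` ball x0 R0 ->
       ball x (2 * lambda * r) `<=` ball x0 (2 * lambda * R0) ->
       forall u g : P -> \bar R,
       newtonian nrm u -> in_lattice nrm g -> weak_upper_gradient nrm u g ->
       let N := nrm (g \_ (ball x (2 * lambda * r))) in
       ((K x r)%:E * N <= c%:E * N)%E).
Proof.
move=> Hmu _ [ctri Hnrm] s1 lambda1 [cPI cPI0 Hpi] [cs cs0 Hdim] a1 a2 Hemb K.
have alpha0 : 0 <= alpha.
  move: s1; rewrite le_eqVlt => /predU1P[/esym/a1|/a2 /ltW]; exact: le_trans.
have s0 : 0 < s by exact: lt_le_trans s1.
have lambda0 : 0 < lambda by exact: lt_le_trans lambda1.
have ctri0 : 0 < ctri by exact: lt_le_trans (qbl_ctri Hnrm).
have [S S0 HS] := sum_rearrangement_norm mu s1 a1 a2.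
pose N := (Num.truncn (lambda `^ s / cs)).+1.
have HN : lambda `^ s / cs <= 2 ^+ N.
  apply: (@le_trans _ _ N%:R); first by rewrite ltW// truncnS_gt.
  by rewrite -natrX ler_nat ltnW// ltn_expl.
pose c1 := cs `^ (- s^-1); have c10 : 0 < c1 by rewrite powR_gt0.
(* This is the bound of [average_close] without its scale and Zygmund norm. *)
pose C0 := 2 * (2 `^ s / cs) * (N%:R + S + 1) * (4 * cPI * c1).
have C00 : 0 < C0.
  by rewrite !mulr_gt0 ?powR_gt0 ?invr_gt0// !addr_gt0.
(* The summands serve the oscillation bound, the comparison of scales, and [C^-1 <= 1]. *)
pose C := C0 * ctri + c1 + 1.
have C0c : 0 < C0 * ctri by rewrite mulr_gt0.
have CC0 : C0 * ctri <= C by rewrite /C -addrA lerDl addr_ge0// ltW.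
have Cc1 : c1 <= C by rewrite /C addrAC lerDr addr_ge0// ltW.
have C1 : 1 <= C by rewrite /C lerDr addr_ge0 ?ltW.
have Cpos : 0 < C by exact: lt_le_trans C1.
have K0 x r : 0 < r -> 0 < K x r.
  by move=> r0; exact: (embedding_scale_gt0 Hmu lambda1 Hemb).
have restr0 (x : P) (r : R) g : in_lattice nrm g -> (0 <= nrm (g \_ (ball x r)))%E.
  move=> [mg _]; apply: (qbl_ge0 Hnrm); exact: (measurable_restrict_ball Hmu).
exists C => // x0 R0 R00; split.
  (* Doubling [R0] makes the dilated ball about [x0] contain [ball x (2 * lambda * r)] whatever the
     position of [x]. *)
  exists (c1 * K x0 (2 * R0)); first by rewrite mulr_gt0// K0// mulr_gt0.
  move=> x r /andP[r0 rR] sub u g uN gX ug; split; last first.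
    rewrite lee_wpmul2r ?restr0// lee_fin.
    apply: (embedding_scale_mono Hmu s1 lambda1 alpha0 cs0 Hdim Hemb).
      by rewrite r0 (le_trans (ltW rR))// ler_peMl ?ler1n// ltW.
    have : ball x0 R0 x by apply: sub; exact: ballxx.
    rewrite ballEmdist/= => x0x; apply: subset_metric_ball.
    have h1 : R0 <= lambda * R0 by rewrite ler_peMl// ltW.
    have h2 : lambda * r <= lambda * R0 by rewrite ler_wpM2l// ltW.
    have -> : 2 * lambda * r = lambda * r + lambda * r by ring.
    have -> : 2 * lambda * (2 * R0) =
      (lambda * R0 + lambda * R0) + (lambda * R0 + lambda * R0) by ring.
    apply: lerD; last exact: lerD.
    apply: (le_trans (ltW x0x)); apply: (le_trans h1).
    by rewrite lerDl mulr_ge0// ltW.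
  have lr0 : 0 < 2 * lambda * r by rewrite !mulr_gt0.
  have [mg gfin] := gX.
  set B := ball x (2 * lambda * r).
  have gB_fin : nrm (g \_ B) \is a fin_num.
    rewrite ge0_fin_numE ?restr0//.
    exact: le_lt_trans (norm_restrict_le Hmu Hnrm _ _ mg) gfin.
  have [g' [rho [bg' g'0 g'g [brho rho0 rhoX] ug']]] :=
    weak_upper_gradient_approx Hmu x ug.
  have uX := newtonian_in_lattice Hmu Hnrm uN.
  have iu y r' : 0 < r' -> mu.-integrable (ball y r') u.
    by move=> r'0; exact: (in_lattice_integrable_ball Hmu Hnrm s1 alpha0 Hemb).
  have avE := average_fin (iu x r r0) (measurable_metric_ball Hmu x r).
  (* The strict inequality leaves room for the perturbation [e * rho] of the upper gradient. *)
  have ess_le (a : R) : C0 * ctri * K x r * fine (nrm (g \_ B)) < a ->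
      (capacity_ess_sup nrm (ball x r)
        (fun y => `|u y - average mu (ball x r) u|) <= a%:E)%E.
    move=> ha; apply: ereal_inf_lbound; exists a => //=.
    rewrite -(fineK avE); apply: (capacity_null_of_null Hmu Hnrm) => //.
      exact: metric_ball_open.
    pose X := C0 * ctri * K x r; pose y := fine (nrm rho).
    have X0 : 0 <= X by rewrite /X mulr_ge0 ?(ltW C0c)// ltW// K0.
    have y0 : 0 <= y by rewrite fine_ge0//; case: rhoX => mrho _; exact: (qbl_ge0 Hnrm).
    (* Then [X * y * e] is smaller than the available margin; the 1 keeps the denominator
       positive. *)
    pose e := (a - X * fine (nrm (g \_ B))) / (X * y + 1).
    have d0 : 0 < X * y + 1 by rewrite ltr_wpDl// mulr_ge0.
    have e0 : 0 < e by apply: divr_gt0 => //; rewrite subr_gt0.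
    pose Z := cemb x (2 * lambda * r) * (ctri * (fine (nrm (g \_ B)) + e * y)).
    have [[c0 _] _] := Hemb x _ lr0.
    have Z0 : 0 <= Z.
      have n0 : 0 <= fine (nrm (g \_ B)) by rewrite fine_ge0// restr0.
      rewrite /Z mulr_ge0 ?(ltW c0)// mulr_ge0 ?(ltW ctri0)// addr_ge0//.
      by rewrite mulr_ge0// ltW.
    have HZ := zygmund_norm_approx Hmu Hnrm Hemb x lr0 e0 mg gfin
      (borel_fun_measurable Hmu bg') g'g rhoX.
    apply: (null_superlevel Hmu s1 lambda1 cPI0 cs0 Hpi Hdim r0 iu (ug' e e0)
      alpha0 Z0 S0 HZ HS HN).
    have -> : 2 * (2 `^ s / cs) * (N%:R + S + 1) * (4 * cPI * cs `^ (- s^-1) *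
        (r / fine (mu (ball x (2 * lambda * r))) `^ s^-1)) * Z =
        X * fine (nrm (g \_ B)) + X * y * e.
      by rewrite /Z /X /C0 /K /embedding_scale -/c1; ring.
    rewrite -ltrBrDl /e mulrA ltr_pdivrMr// mulrC ltr_pM2l ?subr_gt0//.
    by rewrite ltrDl.
  apply: (@le_trans _ _ ((C0 * ctri * K x r)%:E * nrm (g \_ B))%E); last first.
    by rewrite lee_wpmul2r ?restr0// lee_fin ler_wpM2r// ltW// K0.
  rewrite -(fineK gB_fin) -EFinM; apply/lee_addgt0Pr => e e0.
  by apply: ess_le; rewrite ltrDl.
(* Here the inclusion of the dilated balls is given, so [R0] itself serves. *)
exists (c1 * K x0 R0); first by rewrite mulr_gt0// K0.
split.
  have Kx0 := K0 x0 R0 R00; rewrite !(ler_pM2r Kx0) Cc1 andbT.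
  (* Equal radii in the dimension condition give [cs <= 1], whence [1 <= c1]. *)
  apply: (@le_trans _ _ 1); first by rewrite invf_le1.
  have cs1 : cs <= 1.
    have := Hdim x0 x0 R0 R0; rewrite R00 lexx => /(_ isT).
    by rewrite !divff ?gt_eqF ?(vol_gt0 Hmu)// powR1 mulr1; apply; exact: ballxx.
  rewrite /c1 powRN invf_ge1 ?powR_gt0//.
  apply: (@le_trans _ _ (1 `^ s^-1)); last by rewrite powR1.
  by apply: ge0_ler_powR; rewrite ?nnegrE ?invr_ge0 ?(ltW s0) ?(ltW cs0).
move=> x r /andP[r0 rR] sub sub' u g uN gX ug /=.
rewrite lee_wpmul2r ?restr0// lee_fin.
apply: (embedding_scale_mono Hmu s1 lambda1 alpha0 cs0 Hdim Hemb) => //.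
by rewrite r0 ltW.
Qed.
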